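(* Under the standing assumptions in the context, let $\mu^*=\hat\mu^*\cdot\phi^*$ be an optimal solution of the primal problem (P), and let $(h^*,\beta^*,u^* )$ be an optimal solution of the dual problem (D) (both defined in the context). Then $$\langle\mu^*,u^*(z)\rangle=\mathbb E[u^*(Y)],$$ and $$\beta^*+h^*(s)=\sup_{a\in A(s)}\Big\{r(s,a)+u^*(z(s,a))+\int_S h^*(\xi)\,Q(d\xi\mid s,a)\Big\}$$ for $\hat\mu^*$-almost all $s\in S$.
   Context: **MDP setting.** $S$ and $A$ are Borel spaces (Borel subsets of complete separable metric spaces). For each $s\in S$, $A(s)\in\mathcal B(A)$ is the set of feasible actions; $K=\{(s,a)\in S\times A: a\in A(s)\}$ is closed in $S\times A$. $Q(\cdot\mid s,a)$ is a transition law (stochastic kernel on $S$ given $K$); $r,z:K\to\mathbb R$ are measurable. $\mathcal P(\cdot)$ denotes Borel probability measures. With $H_0=S$, $H_t=K^t\times S$, $\Pi$ is the set of history-dependent randomized policies $\pi=(\pi_t)_{t\ge0}$, $\pi_t$ a stochastic kernel on $A$ given $H_t$ concentrated on $A(s_t)$. A policy $\pi$ and $\nu\in\mathcal P(S)$ determine a law $P_\nu^\pi$ (expectation $\mathbb E_\nu^\pi$) of the process $(s_t,a_t)_{t\ge0}$ with $s_0\sim\nu$. **Dominance constraint.** $(x)_-=\min\{x,0\}$. $Y$ is a real random variable with support in a compact interval $[a,b]$, and $y(\eta)=\mathbb E[(Y-\eta)_-]$. Put $$R(\pi,\nu)=\liminf_{T\to\infty}\tfrac1T\mathbb E_\nu^\pi\Big[\sum_{t=0}^{T-1}r(s_t,a_t)\Big],\qquad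 Z_\eta(\pi,\nu)=\liminf_{T\to\infty}\tfrac1T\mathbb E_\nu^\pi\Big[\sum_{t=0}^{T-1}(z(s_t,a_t)-\eta)_-\Big],$$ $\Delta=\{(\pi,\nu)\in\Pi\times\mathcal P(S): R(\pi,\nu)>-\infty,\ Z_\eta(\pi,\nu)\ge y(\eta)\ \forall\eta\in[a,b]\}$. **Spaces and operators.** Let $w=1-r$ on $K$ and $\hat w(s)=1-\sup_{a\in A(s)}r(s,a)$ on $S$. $\mathcal M_w(K)$ is the space of signed Borel measures $\mu$ on $K$ with $\int_K w\,d|\mu|<\infty$; $\mathcal F_w(K)$ is the space of measurable $h:K\to\mathbb R$ with $\sup_K|h|/w<\infty$; $\langle\mu,h\rangle=\int_K h\,d\mu$. $\mathcal F_{\hat w}(S)$ is defined analogously. $\hat\mu$ is the marginal of $\mu$ on $S$, and $\mu=\hat\mu\cdot\phi$ denotes its disintegration $\mu(B\times C)=\int_B\phi(C\mid s)\hat\mu(ds)$ with a stochastic kernel $\phi$ on $A$ given $S$ satisfying $\phi(A(s)\mid s)=1$. $[L_0\mu](B)=\hat\mu(B)-\int_K Q(B\mid s,a)\mu(d(s,a))$; $[L_1\mu](\eta)=\langle\mu,(z-\eta)_-\rangle$, $\eta\in[a,b]$. The set of utility functions is $\mathcal U([a,b])=\{u(x)=\int_a^b(x-\eta)_-\Lambda(d\eta):\Lambda\text{ a finite nonnegative Borel measure on }[a,b]\}$. **Problems.** (P) maximize $\langle\mu,r\rangle$ subject to $L_0\mu=0$, $\langle\mu,1\rangle=1$, $L_1\mu\ge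 y$, $\mu\in\mathcal M_w(K)$, $\mu\ge0$. (D) minimize $\beta-\mathbb E[u(Y)]$ subject to $r(s,a)+u(z(s,a))\le\beta+h(s)-\int_S h(\xi)Q(d\xi\mid s,a)$ for all $(s,a)\in K$, $(h,\beta,u)\in\mathcal F_{\hat w}(S)\times\mathbb R\times\mathcal U([a,b])$. **Standing assumptions.** (1) $\Delta\ne\emptyset$. (2) $r\le0$ and for every $\epsilon\ge0$ the set $\{(s,a)\in K: r(s,a)\ge-\epsilon\}$ is compact. (3) $z$ is bounded and upper semicontinuous on $K$. (4) $Q$ is weakly continuous: $\int_S h(\xi)Q(d\xi\mid\cdot)$ is bounded continuous on $K$ for every bounded continuous $h$ on $S$. (5) $(z-\eta)_-\in\mathcal F_w(K)$ for all $\eta\in[a,b]$. (6) $\int_S\hat w(\xi)Q(d\xi\mid\cdot)\in\mathcal F_w(K)$. *)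

(* Defs.v *)
From HB Require Import structures.
From mathcomp Require Import all_boot all_order all_algebra.
From mathcomp Require Import all_classical all_reals all_analysis.

Set Implicit Arguments.
Unset Strict Implicit.
Unset Printing Implicit Defensive.
Import Order.TTheory GRing.Theory Num.Theory.
Import numFieldNormedType.Exports.
Local Open Scope classical_set_scope.
Local Open Scope ring_scope.

Notation borel T := (g_sigma_algebraType (@open T)).

Definition complete_separable (R : realType) (X : metricType R) : Prop :=
  (forall F : set_system X, ProperFilter F -> cauchy F ->
     exists x : X, F --> x) /\
  (exists2 C : set X, countable C & dense C).

(* The structure of a Borel space does not single out the ambient metric:
   S carries the topology induced by an injection onto a Borel subset of a
   complete separable metric space, so S "is" such a subset. *)
Definition borel_space (R : realType) (S : topologicalType) : Prop :=
  exists (X : metricType R) (f : S -> X),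
    [/\ complete_separable X, injective f,
        (forall U : set S, open U <-> exists2 V : set X, open V & f @^-1` V = U)
      & <<s @open X >> (range f)].

(* Nonemptiness of A(s) is forced by the existence of a policy, since
   pi_0(A(s) | s) = 1 for every s; it is recorded here because measurable
   types have to be pointed. *)
Record action_map (S A : ptopologicalType) := ActionMap {
  actions :> S -> set A ;
  actions_measurable : forall s, measurable (actions s : set (borel A)) ;
  actions_neq0 : forall s, actions s !=set0 }.

Section MDP.
Context {R : realType} {S A : ptopologicalType}.

Definition graph (D : action_map S A) : set (S * A) := [set x | D x.1 x.2].

Lemma graph_neq0 (D : action_map S A) : exists x, x \in graph D.
Proof. by have [a Da] := actions_neq0 D point; exists (point, a); exact/mem_set. Qed.

Definition pairs (D : action_map S A) : Type := set_type (graph D).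

HB.instance Definition _ (D : action_map S A) :=
  Topological.on (pairs D).
HB.instance Definition _ (D : action_map S A) :=
  isPointed.Build (pairs D)
    (exist _ (projT1 (cid (graph_neq0 D))) (projT2 (cid (graph_neq0 D)))).

Context {D : action_map S A}.
Let K : ptopologicalType := pairs D.

Definition state (k : pairs D) : S := (set_val k).1.
Definition action (k : pairs D) : A := (set_val k).2.

Lemma measurable_state :
  measurable_fun [set: borel K] (state : borel K -> borel S).
Proof.
have cs : continuous (state : K -> S).
  move=> k; apply: (@continuous_comp K (S * A)%type S (fun k : K => set_val k) fst).
    exact: initial_continuous.
  exact: cvg_fst.
apply: (@measurability _ _ (borel K) (borel S) setT _ (@open S)) => //.
move=> _ [U oU <-]; apply: sub_sigma_algebra; rewrite setTI.
by move/continuousP : cs; apply.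
Qed.

Definition neg_part (x : R) : R := Num.min x 0.

Definition upper_semicontinuous (T : topologicalType) (f : T -> R) : Prop :=
  forall x a, f x < a -> exists2 V, nbhs x V & forall y, V y -> f y < a.

Definition weakly_continuous (Q : R.-pker (borel K) ~> (borel S)) : Prop :=
  forall h : S -> R, continuous h -> (exists M, forall s, `|h s| <= M) ->
    continuous (fun k : K => \int[Q k]_x h x) /\
    (exists M, forall k : K, `|\int[Q k]_x h x| <= M).

Definition weight (r : K -> R) (k : K) : R := 1 - r k.

Definition state_weight (r : K -> R) (s : S) : R :=
  1 - sup [set r k | k in [set k : K | state k = s]].

Definition F_ (T : ptopologicalType) (w : T -> R) (h : T -> R) : Prop :=
  measurable_fun [set: borel T] h /\
  has_ubound (range (fun x => `|h x| / w x)).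

Definition history (t : nat) := (t.-tuple (borel K) * borel S)%type.

Record policy := Policy {
  decision :> forall t, R.-pker (history t) ~> (borel A) ;
  decision_feasible : forall t (h : history t), decision t h (D h.2) = 1%E }.

Definition coordinate_cylinders : set (set (nat -> borel K)) :=
  [set C | exists t (B : set (borel K)),
     measurable B /\ C = [set k | B (k t)]].

Definition trajectory := g_sigma_algebraType coordinate_cylinders.

Definition history_of (t : nat) (k : trajectory) : history t :=
  ([tuple of [seq k i | i <- iota 0 t]], state (k t)).

(* The process lives in K^nat because a_t belongs to A(s_t) almost surely; by
   the Ionescu-Tulcea theorem these properties determine exactly one P. *)
Definition is_law (Q : R.-pker (borel K) ~> (borel S)) (pi : policy)
    (nu : probability (borel S) R) (P : probability trajectory R) : Prop :=
  [/\ forall B : set (borel S), measurable B ->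
        P [set k | B (state (k 0%N))] = nu B,
      forall t (H : set (history t)) (C : set (borel A)),
        measurable H -> measurable C ->
        P [set k | H (history_of t k) /\ C (action (k t))] =
        (\int[P]_(k in [set k | H (history_of t k)])
           pi t (history_of t k) C)%E
    & forall t (H : set (t.+1.-tuple (borel K))) (B : set (borel S)),
        measurable H -> measurable B ->
        P [set k | H (history_of t.+1 k).1 /\ B (state (k t.+1))] =
        (\int[P]_(k in [set k | H (history_of t.+1 k).1]) Q (k t) B)%E].

Definition average (P : probability trajectory R) (f : K -> R) : \bar R :=
  limn_einf (fun T => (T%:R^-1)%:E *
    'E_P[fun k : trajectory => (\sum_(t < T) f (k t))%R])%E.

Definition benchmark d (Omega : measurableType d) (PY : probability Omega R)
    (Y : {RV PY >-> R}) (eta : R) : \bar R :=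
  'E_PY[fun omega => neg_part (Y omega - eta)]%E.

Definition Delta (Q : R.-pker (borel K) ~> (borel S)) (r z : K -> R) (a b : R)
    (y : R -> \bar R) (pi : policy) (nu : probability (borel S) R) : Prop :=
  exists P, [/\ is_law Q pi nu P, (-oo < average P r)%E
    & forall eta, a <= eta <= b ->
        (y eta <= average P (fun k => neg_part (z k - eta)))%E].

Definition marginal (mu : {measure set (borel K) -> \bar R}) :
    set (borel S) -> \bar R :=
  pushforward mu (state : borel K -> borel S).

Section marginal_measure.
Variable mu : {measure set (borel K) -> \bar R}.

Let marginal0 : marginal mu set0 = 0%E.
Proof. by rewrite /marginal /pushforward preimage_set0 measure0. Qed.

Let marginal_ge0 B : (0 <= marginal mu B)%E.
Proof. by rewrite /marginal /pushforward; exact: measure_ge0. Qed.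

Let marginal_sigma_additive : semi_sigma_additive (marginal mu).
Proof.
move=> F mF tF mUF; rewrite /marginal /pushforward preimage_bigcup.
apply: measure_semi_sigma_additive.
- by move=> n; rewrite -[X in measurable X]setTI; apply: measurable_state; rewrite ?setTI.
- apply/trivIsetP => /= i j _ _ ij; rewrite -preimage_setI.
  by move/trivIsetP : tF => /(_ _ _ _ _ ij) ->//; rewrite preimage_set0.
- by rewrite -preimage_bigcup -[X in measurable X]setTI; exact: measurable_state.
Qed.

HB.instance Definition _ := isMeasure.Build _ _ _ (marginal mu)
  marginal0 marginal_ge0 marginal_sigma_additive.

End marginal_measure.

Definition disintegration (mu : {measure set (borel K) -> \bar R})
    (phi : R.-pker (borel S) ~> (borel A)) : Prop :=
  (forall s, phi s (D s) = 1%E) /\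
  forall (B : set (borel S)) (C : set (borel A)),
    measurable B -> measurable C ->
    mu [set k | B (state k) /\ C (action k)] =
    (\int[marginal mu]_(s in B) phi s C)%E.

Definition L0 (Q : R.-pker (borel K) ~> (borel S))
    (mu : {measure set (borel K) -> \bar R}) (B : set (borel S)) : \bar R :=
  (marginal mu B - \int[mu]_k Q k B)%E.

Definition L1 (z : K -> R) (mu : {measure set (borel K) -> \bar R}) (eta : R) :
    \bar R :=
  (\int[mu]_k (neg_part (z k - eta))%:E)%E.

(* A nonnegative element of M_w(K) is a finite measure integrating w. *)
Definition primal_feasible (Q : R.-pker (borel K) ~> (borel S)) (r z : K -> R)
    (a b : R) (y : R -> \bar R)
    (mu : {finite_measure set (borel K) -> \bar R}) : Prop :=
  [/\ (\int[mu]_k (weight r k)%:E < +oo)%E,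
      forall B : set (borel S), measurable B -> L0 Q mu B = 0%E,
      (\int[mu]_k 1 = 1)%E
    & forall eta, a <= eta <= b -> (y eta <= L1 z mu eta)%E].

Definition primal_optimal (Q : R.-pker (borel K) ~> (borel S)) (r z : K -> R)
    (a b : R) (y : R -> \bar R)
    (mu : {finite_measure set (borel K) -> \bar R}) : Prop :=
  primal_feasible Q r z a b y mu /\
  forall mu' : {finite_measure set (borel K) -> \bar R},
    primal_feasible Q r z a b y mu' ->
    (\int[mu']_k (r k)%:E <= \int[mu]_k (r k)%:E)%E.

Definition utility (a b : R) (u : R -> R) : Prop :=
  exists Lambda : {finite_measure set R -> \bar R},
    forall x, u x = \int[Lambda]_(eta in `[a, b]) neg_part (x - eta).

Definition dual_feasible (Q : R.-pker (borel K) ~> (borel S)) (r z : K -> R)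
    (a b : R) (h : S -> R) (beta : R) (u : R -> R) : Prop :=
  [/\ F_ (state_weight r) h, utility a b u
    & forall k : K,
        r k + u (z k) <= beta + h (state k) - \int[Q k]_x h x].

Definition dual_value d (Omega : measurableType d) (PY : probability Omega R)
    (Y : {RV PY >-> R}) (beta : R) (u : R -> R) : \bar R :=
  (beta%:E - 'E_PY[u \o Y])%E.

Definition dual_optimal (Q : R.-pker (borel K) ~> (borel S)) (r z : K -> R)
    (a b : R) d (Omega : measurableType d) (PY : probability Omega R)
    (Y : {RV PY >-> R}) (h : S -> R) (beta : R) (u : R -> R) : Prop :=
  dual_feasible Q r z a b h beta u /\
  forall h' beta' u', dual_feasible Q r z a b h' beta' u' ->
    (dual_value Y beta u <= dual_value Y beta' u')%E.

End MDP.

Arguments policy R {S A} D.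

(* Main.v *)
(* Complementary slackness follows from the absence of a duality gap, which is
   proved with the multipliers h restricted to bounded continuous functions.

   Let v be the dual value and, for f bounded on K, let p(f) be the infimum of
   b' - E[u'(Y)] - t v over all t >= 0, h', b', u' with
   f + t r + u'(z) <= b' + h' - Qh'. Weak duality and dual optimality make p
   finite, and it is sublinear. By Hahn-Banach it dominates a linear functional
   E, which is positive, has E(1) = 1, annihilates h' - Qh' for h' bounded
   continuous, and satisfies E((z - eta)_-) >= y(eta) and E(f) <= -v for bounded
   f <= -r. As the sets {r >= -n} are compact, the last property makes E tight,
   so that the finitely additive set function E(1_A) yields a Borel probability
   P with P(U) <= E(1_U) for U open, hence with P(g) >= E(g) for g bounded upper
   semicontinuous. P is then feasible for (P) with P(r) >= v.

   The slack of the dual constraint thus vanishes mu-almost everywhere. By inner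
   regularity the set where it vanishes contains a sigma-compact set of full
   measure, whose projection to S is Borel; over every s in this projection the
   supremum is attained. *)
Require Import Defs.
From HB Require Import structures.
From mathcomp Require Import all_boot all_order all_algebra.
From mathcomp Require Import all_classical all_reals all_analysis.
From mathcomp Require Import measurable_realfun lra.

Set Implicit Arguments.
Unset Strict Implicit.
Unset Printing Implicit Defensive.
Import Order.TTheory GRing.Theory Num.Theory.
Import numFieldNormedType.Exports.
Local Open Scope classical_set_scope.
Local Open Scope ring_scope.

(** * Hahn-Banach *)

Section hahn_banach.
Context {R : realType} {V : lmodType R}.
Implicit Types (B : set V) (p q : V -> R) (x y : V).

Definition subspace_set B :=
  [/\ B 0, forall x y, B x -> B y -> B (x + y)
    & forall (c : R) x, B x -> B (c *: x)].

Definition sublinear B p :=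
  (forall x y, B x -> B y -> p (x + y) <= p x + p y) /\
  (forall (c : R) x, 0 <= c -> B x -> p (c *: x) = c * p x).

Lemma sublinear0 B p : subspace_set B -> sublinear B p -> p 0 = 0.
Proof.
move=> [B0 _ _] [_ pZ].
by have := pZ 0 0 (lexx _) B0; rewrite scale0r mul0r.
Qed.

Lemma sublinear_geN B p x : subspace_set B -> sublinear B p -> B x ->
  - p (- x) <= p x.
Proof.
move=> sB sp Bx; have [_ _ BZ] := sB; have [pD _] := sp.
have BNx : B (- x) by rewrite -scaleN1r; exact: BZ.
have := pD _ _ Bx BNx; rewrite subrr (sublinear0 sB sp).
by rewrite -lerBlDr sub0r.
Qed.

(* The infimum of q(y + t x) - t q(x) over t >= 0 is sublinear and at most q,
   hence equals q when q is minimal, which forces q(x + y) >= q(x) + q(y). *)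
Lemma minimal_sublinear_linear B q : subspace_set B -> sublinear B q ->
  (forall q', sublinear B q' -> (forall x, B x -> q' x <= q x) ->
     forall x, B x -> q' x = q x) ->
  (forall x y, B x -> B y -> q (x + y) = q x + q y) /\
  (forall (c : R) x, B x -> q (c *: x) = c * q x).
Proof.
move=> sB sq qmin; have [B0 BD BZ] := sB; have [qD qZ] := sq.
have BN x : B x -> B (- x) by move=> Bx; rewrite -scaleN1r; exact: BZ.
have qadd x y : B x -> B y -> q (x + y) = q x + q y.
  move=> Bx By; apply/eqP; rewrite eq_le qD//=.
  pose I y := [set q (y + t *: x) - t * q x | t in [set t : R | 0 <= t]].
  pose q' y := inf (I y).
  have Ine y' : I y' !=set0 by exists (q (y' + 0 *: x) - 0 * q x), 0 => /=.
  have Ilb y' : B y' -> lbound (I y') (- q (- y')).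
    move=> By' _ [t t0 <-].
    have := qD _ _ (BD _ _ By' (BZ t x Bx)) (BN _ By').
    by rewrite addrAC subrr add0r qZ//; lra.
  have hI y' : B y' -> has_inf (I y').
    by move=> By'; split=> //; exists (- q (- y')); exact: Ilb.
  have q'le y' t : B y' -> 0 <= t -> q' y' <= q (y' + t *: x) - t * q x.
    by move=> By' t0; apply: ge_inf; [case: (hI _ By')|exists t].
  have sq' : sublinear B q'.
    split=> [y1 y2 B1 B2|c y1].
      rewrite -lerBlDr; apply: lb_le_inf => // _ [t1 t10 <-].
      rewrite lerBlDr -lerBlDl; apply: lb_le_inf => // _ [t2 t20 <-].
      have := q'le _ (t1 + t2) (BD _ _ B1 B2) (addr_ge0 t10 t20).
      have := qD _ _ (BD _ _ B1 (BZ t1 x Bx)) (BD _ _ B2 (BZ t2 x Bx)).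
      rewrite (_ : y1 + t1 *: x + _ = y1 + y2 + (t1 + t2) *: x); last first.
        by rewrite scalerDl addrACA.
      lra.
    rewrite le_eqVlt => /predU1P[<-|c0] B1.
      rewrite scale0r mul0r; apply/eqP; rewrite eq_le; apply/andP; split.
        have := q'le 0 0 B0 (lexx _).
        by rewrite scale0r addr0 mul0r subr0 (sublinear0 sB sq).
      apply: lb_le_inf => // _ [t t0 <-].
      by rewrite add0r qZ// subrr.
    apply/eqP; rewrite eq_le; apply/andP; split.
      rewrite -ler_pdivrMl//; apply: lb_le_inf => // _ [t t0 <-].
      rewrite ler_pdivrMl// mulrBr -(qZ c) ?(ltW c0)//; last first.
        by apply: BD => //; exact: BZ.
      rewrite scalerDr scalerA mulrA; apply: q'le; first exact: BZ.
      by rewrite mulr_ge0// ltW.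
    apply: lb_le_inf => // _ [t t0 <-].
    have tc0 : 0 <= c^-1 * t by rewrite mulr_ge0// invr_ge0 ltW.
    have := q'le _ _ B1 tc0; rewrite -(ler_pM2l c0) => /le_trans; apply.
    rewrite mulrBr -(qZ c) ?(ltW c0)//; last by apply: BD => //; exact: BZ.
    by rewrite scalerDr scalerA !mulrA divff ?gt_eqF// !mul1r.
  have q'q x' : B x' -> q' x' <= q x'.
    move=> Bx'; have := q'le x' 0 Bx' (lexx _).
    by rewrite scale0r addr0 mul0r subr0.
  have := qmin q' sq' q'q y By => <-.
  have := q'le y 1 By ler01; rewrite scale1r mul1r [y + x]addrC; lra.
split=> // c x Bx; have [c0|c0] := leP 0 c; first exact: qZ.
have := qadd _ _ (BZ c x Bx) (BZ (- c) x Bx).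
rewrite -scalerDl subrr scale0r (sublinear0 sB sq) (qZ (- c))//; last lra.
lra.
Qed.

(** Zorn's lemma yields a minimal sublinear functional below [p], which is linear by
    [minimal_sublinear_linear]. All laws are relativized to [B], so that [V] can be a full function
    space and [B] its bounded functions. *)
Theorem hahn_banach_dominated B p : subspace_set B -> sublinear B p ->
  exists l : V -> R,
  [/\ forall x y, B x -> B y -> l (x + y) = l x + l y,
      forall (c : R) x, B x -> l (c *: x) = c * l x
    & forall x, B x -> l x <= p x].
Proof.
move=> sB sp; have [B0 BD BZ] := sB.
have BN x : B x -> B (- x) by move=> Bx; rewrite -scaleN1r; exact: BZ.
(* Vanishing outside B makes the pointwise order on B antisymmetric. *)
pose T := {q : V -> R | [/\ sublinear B q, (forall x, B x -> q x <= p x)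
                          & forall x, ~ B x -> q x = 0]}.
(* The order is reversed: maximal elements for [rel] are the pointwise minimal functionals. *)
pose rel (q1 q2 : T) := `[< forall x, B x -> sval q2 x <= sval q1 x >].
pose restr (q : V -> R) x := if x \in B then q x else 0.
have restrE q x : B x -> restr q x = q x by move=> Bx; rewrite /restr mem_set.
have restrN q x : ~ B x -> restr q x = 0 by move=> Bx; rewrite /restr memNset.
have restr_sub q : sublinear B q -> sublinear B (restr q).
  move=> [qD qZ]; split=> [x y Bx By|c x c0 Bx].
    by rewrite !restrE ?qD//; exact: BD.
  by rewrite !restrE ?qZ//; exact: BZ.
have [||||[q [sq qp q0]] qmin] := @Zorn T rel.
- by move=> q; apply/asboolP.
- move=> q1 q2 q3 /asboolP h1 /asboolP h2; apply/asboolP => x Bx.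
  exact: le_trans (h2 _ Bx) (h1 _ Bx).
- move=> [q1 [s1 p1 z1]] [q2 [s2 p2 z2]] /asboolP/= h1 /asboolP/= h2.
  apply: eq_exist => /=; apply/funext => x; have [Bx|Bx] := pselect (B x).
    by apply/eqP; rewrite eq_le h1// h2.
  by rewrite z1// z2.
(* The empty chain is bounded by [p] itself, a nonempty one by its pointwise infimum. *)
- move=> A totA; have [[a Aa]|Ane] := pselect (exists a, A a); last first.
    have pr : [/\ sublinear B (restr p), (forall x, B x -> restr p x <= p x)
                & forall x, ~ B x -> restr p x = 0].
      by split=> [|x Bx|]; [exact: restr_sub|rewrite restrE|exact: restrN].
    by exists (exist _ (restr p) pr) => s As; exfalso; apply: Ane; exists s.
  pose I x := [set sval s x | s in A].
  have Ine x : I x !=set0 by exists (sval a x), a.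
  (* Every functional in the chain lies above - p (- x), which keeps the infimum finite. *)
  have Ilb x : B x -> lbound (I x) (- p (- x)).
    move=> Bx _ [s As <-]; have [ss sp' _] := svalP s.
    apply: le_trans (sublinear_geN sB ss Bx).
    by rewrite lerN2; apply: sp'; exact: BN.
  have qle x s : B x -> A s -> inf (I x) <= sval s x.
    by move=> Bx As; apply: ge_inf; [exists (- p (- x)); exact: Ilb|exists s].
  have sI : sublinear B (fun x => inf (I x)).
    split=> [x y Bx By|c x].
      rewrite -lerBlDr; apply: lb_le_inf => // _ [s As <-].
      rewrite lerBlDr -lerBlDl; apply: lb_le_inf => // _ [t At <-].
      rewrite lerBlDl.
      (* The chain makes [s] and [t] comparable, so the smaller of the two bounds both terms. *)
      have [/asboolP st|/asboolP ts] := totA _ _ As At.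
        have [[tD _] _ _] := svalP t.
        apply: le_trans (qle _ _ (BD _ _ Bx By) At) _.
        by apply: le_trans (tD _ _ Bx By) _; rewrite lerD2r st.
      have [[sD _] _ _] := svalP s.
      apply: le_trans (qle _ _ (BD _ _ Bx By) As) _.
      by apply: le_trans (sD _ _ Bx By) _; rewrite lerD2l ts.
    rewrite le_eqVlt => /predU1P[<-|c0] Bx.
      have -> : I (0 *: x) = [set 0].
        rewrite scale0r; apply/seteqP; split=> [_ [s As <-]|_ ->].
          by have [ss _ _] := svalP s; rewrite /= (sublinear0 sB ss).
        by exists a => //; have [ss _ _] := svalP a; rewrite (sublinear0 sB ss).
      by rewrite inf1 mul0r.
    apply/eqP; rewrite eq_le; apply/andP; split.
      rewrite -ler_pdivrMl//; apply: lb_le_inf => // _ [s As <-].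
      have [[_ sZ] _ _] := svalP s.
      rewrite ler_pdivrMl// -(sZ c) ?(ltW c0)//; apply: qle => //; exact: BZ.
    apply: lb_le_inf => // _ [s As <-]; have [[_ sZ] _ _] := svalP s.
    by rewrite sZ// ?(ltW c0)// ler_pM2l//; exact: qle.
  have prI : [/\ sublinear B (restr (fun x => inf (I x))),
      (forall x, B x -> restr (fun x => inf (I x)) x <= p x)
      & forall x, ~ B x -> restr (fun x => inf (I x)) x = 0].
    split=> [|x Bx|]; [exact: restr_sub| |exact: restrN].
    rewrite restrE//; apply: le_trans (qle x a Bx Aa) _.
    by have [_ ap _] := svalP a; exact: ap.
  exists (exist _ (restr (fun x => inf (I x))) prI) => s As; apply/asboolP => x Bx /=.
  by rewrite restrE//; exact: qle.
have [] := @minimal_sublinear_linear B q sB sq; last by move=> qD qZ; exists q.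
move=> q' sq' q'q x Bx.
have pr : [/\ sublinear B (restr q'), (forall x, B x -> restr q' x <= p x)
            & forall x, ~ B x -> restr q' x = 0].
  split=> [|y By|]; [exact: restr_sub| |exact: restrN].
  by rewrite restrE//; exact: le_trans (q'q _ By) (qp _ By).
have /(congr1 sval)/= : exist _ (restr q') pr = exist _ q (And3 sq qp q0) :> T.
  by apply: qmin; apply/asboolP => y By /=; rewrite restrE//; exact: q'q.
by move=> /(congr1 (@^~ x)); rewrite restrE.
Qed.

End hahn_banach.

(** * Cozero sets and induced topologies *)

Section cozero.
Context {R : realType}.

(** This consequence of metrizability is all that the measure theory below takes from a metric.
    Unlike a metric, it passes to an induced topology without further structure. *)
Definition cozero_opens (T : topologicalType) :=
  forall U : set T, open U ->
    exists f : T -> R, [/\ continuous f, forall x, 0 <= f x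
                         & U = [set x | 0 < f x]].

(** The function is the radius, capped at 1, of the largest ball around the point inside [U]; [flip]
    says that it is 1-Lipschitz. *)
Lemma pseudometric_cozero_opens (T : pseudoMetricType R) : cozero_opens T.
Proof.
move=> U oU.
(* The guard [0 < e] keeps 0 in [I x] even for [x] outside [U], and the cap keeps the supremum
   finite when [U] is the whole space. *)
pose I x := [set e : R | 0 <= e <= 1 /\ (0 < e -> ball x e `<=` U)].
have I0 x : I x 0 by split; [rewrite lexx ler01|rewrite ltxx].
have hI x : has_sup (I x).
  by split; [exists 0|exists 1 => e [/andP[]]].
pose f x := sup (I x).
have f0 x : 0 <= f x by apply: (ub_le_sup (hI x).2); exact: I0.
have flip x y d : 0 < d -> ball x d y -> f x - d <= f y.
  move=> d0 xy; rewrite lerBlDr; apply: ge_sup => [|e [/andP[e0 e1] eU]].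
    by exists 0.
  have [ed|de] := leP e d; first by rewrite -[e]add0r lerD.
  rewrite -lerBlDr; apply: (ub_le_sup (hI y).2); split.
    by rewrite subr_ge0 ltW//= lerBlDr (le_trans e1)// lerDl ltW.
  move=> _ z yz; apply: (eU (lt_trans d0 de)).
  by rewrite -[e](subrK d) addrC; exact: ball_triangle xy yz.
exists f; split=> //.
- move=> x; apply/cvgrPdist_le => d d0; near=> y.
  have xy : ball x d y by near: y; exact: nbhsx_ballx.
  rewrite ler_norml; apply/andP; split.
    by have := flip _ _ _ d0 (ball_sym xy); lra.
  by have := flip _ _ _ d0 xy; lra.
- apply/seteqP; split=> [x Ux/=|x/= fx].
    have /nbhs_ballP[e/= e0 eU] := open_nbhs_nbhs (conj oU Ux).
    have m0 : 0 < Num.min e 1 by rewrite lt_min e0 ltr01.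
    apply: (lt_le_trans m0); apply: (ub_le_sup (hI x).2); split.
      by rewrite ltW//= ge_min lexx orbT.
    by move=> _; apply: subset_trans eU; apply: le_ball; rewrite ge_min lexx.
  have [e [_ eU] e0] := sup_gt (ex_intro _ _ (I0 x)) fx.
  by apply: (eU e0); exact: ballxx.
Unshelve. all: by end_near. Qed.

(** The topological clause of [borel_space], isolated so that it can be composed and multiplied. *)
Definition induced_by (T X : topologicalType) (f : T -> X) :=
  forall U : set T, open U <-> exists2 V : set X, open V & f @^-1` V = U.

Lemma induced_continuous (T X : topologicalType) (f : T -> X) :
  induced_by f -> continuous f.
Proof. by move=> fi; apply/continuousP => V oV; apply/fi; exists V. Qed.

Lemma induced_cozero_opens (T X : topologicalType) (f : T -> X) :
  induced_by f -> cozero_opens X -> cozero_opens T.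
Proof.
move=> fi cX U /fi[V /cX[g [cg g0 VE]] <-]; exists (g \o f); split=> //.
- by move=> x; apply: continuous_comp; [exact: induced_continuous|exact: cg].
- by move=> x; exact: g0.
- by rewrite VE.
Qed.

Lemma induced_hausdorff (T X : topologicalType) (f : T -> X) :
  induced_by f -> injective f -> hausdorff_space X -> hausdorff_space T.
Proof.
move=> fi finj hX x y clxy; apply: finj; apply: hX => U V Ux Vy.
have cf := induced_continuous fi.
have [t [Ut Vt]] := clxy _ _ (cf x _ Ux) (cf y _ Vy).
by exists (f t).
Qed.

End cozero.

(** * From tight finitely additive set functions to measures *)

Section inner_compact_measure.
Context {R : realType} {T : ptopologicalType}.
Hypotheses (T_cozero : @cozero_opens R T) (T_hausdorff : hausdorff_space T).
Variable m : set T -> R.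
Hypotheses (m_ge0 : forall A, 0 <= m A)
  (mU : forall A B, A `&` B = set0 -> m (A `|` B) = m A + m B)
  (mT : m setT = 1)
  (m_tight : forall e, 0 < e -> exists2 C, compact C & 1 - e <= m C).
Implicit Types A B C U V W : set T.

Let m0 : m set0 = 0.
Proof. by have := mU (setIid set0); rewrite setUid; lra. Qed.

Let m_mono A B : A `<=` B -> m A <= m B.
Proof.
move=> AB; rewrite -(setDUK AB) mU ?lerDl//.
by rewrite setDE setIA setIAC setICr set0I.
Qed.

Let mU_le A B : m (A `|` B) <= m A + m B.
Proof.
have -> : A `|` B = A `|` (B `\` A).
  apply/seteqP; split=> [x [Ax|Bx]|x [Ax|[Bx _]]]; [by left| |by left|by right].
  by have [Ax|Ax] := pselect (A x); [left|right].
rewrite mU ?lerD2l; first by apply: m_mono; exact: subDsetl.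
by rewrite setDE setIC -setIA setICl setI0.
Qed.

(** Compactness turns finite into countable subadditivity on open sets. [outer_charge] then extends
    this to an outer measure, and Caratheodory's construction gives the Borel measure. *)
Definition inner_charge U : \bar R :=
  ereal_sup [set (m C)%:E | C in [set C | compact C /\ C `<=` U]].

Definition outer_charge A : \bar R :=
  ereal_inf [set inner_charge U | U in [set U | open U /\ A `<=` U]].

Let inner_ub C U : compact C -> C `<=` U -> ((m C)%:E <= inner_charge U)%E.
Proof. by move=> cC CU; apply: ereal_sup_ubound; exists C. Qed.

Let inner_ge0 U : (0 <= inner_charge U)%E.
Proof. by have /inner_ub := @compact0 T; rewrite m0; apply. Qed.

Lemma inner_charge_le U : (inner_charge U <= (m U)%:E)%E.
Proof. by apply: ge_ereal_sup => _ [C [cC CU] <-]; rewrite lee_fin m_mono. Qed.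

Let inner_le1 U : (inner_charge U <= 1)%E.
Proof.
by apply: (le_trans (inner_charge_le U)); rewrite -mT lee_fin m_mono.
Qed.

Let inner_mono U V : U `<=` V -> (inner_charge U <= inner_charge V)%E.
Proof.
move=> UV; apply: ge_ereal_sup => _ [C [cC CU] <-].
by apply: inner_ub => //; exact: subset_trans UV.
Qed.

(* With U = {f > 0} and V = {g > 0}, split C along {f >= g} and {f <= g}. *)
Let compact_split C U V : open U -> open V -> compact C -> C `<=` U `|` V ->
  exists C1 C2, [/\ compact C1, compact C2, C1 `<=` U, C2 `<=` V
                  & C = C1 `|` C2].
Proof.
move=> /T_cozero[f [cf f0 ->]] /T_cozero[g [cg g0 ->]] cC CUV.
have clC := compact_closed T_hausdorff cC.
pose D1 := [set x | 0 <= f x - g x]; pose D2 := [set x | 0 <= g x - f x].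
have clD (k : T -> R) : continuous k -> closed [set x | 0 <= k x].
  by move=> ck; apply: (preimage_closed _ (@closed_ge _ 0)) => y _; exact: ck.
have clD1 : closed D1 by apply: clD => x; apply: cvgB; [exact: cf|exact: cg].
have clD2 : closed D2 by apply: clD => x; apply: cvgB; [exact: cg|exact: cf].
exists (C `&` D1), (C `&` D2); split.
- exact: compact_closedI.
- exact: compact_closedI.
- move=> x [/CUV/= [//|gx]]; rewrite /D1/= subr_ge0; exact: lt_le_trans.
- move=> x [/CUV/= [|//]]; rewrite /D2/= subr_ge0 => fx; exact: lt_le_trans.
- rewrite -setIUr; apply/esym/setIidPl => x _; rewrite /D1/D2/= !subr_ge0.
  by case/orP: (le_total (g x) (f x)); [left|right].
Qed.

(** A compact subset of the union is covered by finitely many [U i], and [compact_split] distributes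
    it among them. *)
Let inner_bigcup (U : (set T)^nat) : (forall i, open (U i)) ->
  (inner_charge (\bigcup_i U i) <= \sum_(i <oo) inner_charge (U i))%E.
Proof.
move=> oU; apply: ge_ereal_sup => _ [C [cC CU] <-].
have oW n : open (\big[setU/set0]_(i < n) U i).
  by elim/big_ind : _ => [|? ? ? ?|i _]; [exact: open0|exact: openU|exact: oU].
have fin n C' : compact C' -> C' `<=` \big[setU/set0]_(i < n) U i ->
    ((m C')%:E <= \sum_(i < n) inner_charge (U i))%E.
  elim: n C' => [|n IH] C' cC'.
    by rewrite !big_ord0 subset0 => ->; rewrite m0.
  rewrite !big_ord_recr/= => C'U.
  have [C1 [C2 [cC1 cC2 C1U C2U ->]]] := compact_split (oW n) (oU n) cC' C'U.
  apply: (@le_trans _ _ ((m C1)%:E + (m C2)%:E)%E).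
    by rewrite -EFinD lee_fin.
  by apply: leeD; [exact: IH|exact: inner_ub].
move: cC; rewrite compact_cover => cC.
have [i _||D' _ CD'] := cC nat setT U; [exact: oU|exact: CU|].
pose n := (\max_(i <- finmap.enum_fset D') i).+1.
have CUn : C `<=` \big[setU/set0]_(i < n) U i.
  move=> x /CD'[i/= iD' Uix]; rewrite -bigcup_mkord; exists i => //=.
  by rewrite /n ltnS; exact: (@leq_bigmax_seq _ _ xpredT id).
have cC' : compact C by rewrite compact_cover.
apply: le_trans (fin n C cC' CUn) _.
by rewrite -(big_mkord xpredT (fun i => inner_charge (U i))) nneseries_lim_ge.
Qed.

Let outer_ge0 A : (0 <= outer_charge A)%E.
Proof. by apply: le_ereal_inf_tmp => _ [U _ <-]. Qed.

Let outer_open U : open U -> outer_charge U = inner_charge U.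
Proof.
move=> oU; apply/eqP; rewrite eq_le; apply/andP; split.
  by apply: ereal_inf_lbound; exists U => //; split.
by apply: le_ereal_inf_tmp => _ [V [oV UV] <-]; exact: inner_mono.
Qed.

Let outer0 : outer_charge set0 = 0%E.
Proof.
rewrite outer_open; last exact: open0.
apply/eqP; rewrite eq_le inner_ge0 andbT.
by apply: (le_trans (inner_charge_le _)); rewrite m0.
Qed.

Let outer_mono : {homo outer_charge : A B / A `<=` B >-> (A <= B)%E}.
Proof.
move=> A B AB; apply: le_ereal_inf_tmp => _ [V [oV BV] <-].
by apply: ereal_inf_lbound; exists V => //; split=> //; exact: subset_trans BV.
Qed.

Let outer_le1 A : (outer_charge A <= 1)%E.
Proof.
apply: (le_trans (outer_mono (@subsetT _ A))).
by rewrite outer_open; [exact: inner_le1|exact: openT].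
Qed.

Let outer_fin A : outer_charge A \is a fin_num.
Proof. by rewrite ge0_fin_numE// (le_lt_trans (outer_le1 A)) ?ltry. Qed.

Let outer_sigma_subadditive : sigma_subadditive outer_charge.
Proof.
move=> A; apply/lee_addgt0Pr => e e0.
rewrite (le_trans _ (epsilon_trick _ _ _))//; last by rewrite ltW.
have [U UP] : {U : (set T)^nat & forall i, [/\ open (U i), A i `<=` U i
    & (inner_charge (U i) <= outer_charge (A i) + (e / (2 ^ i.+1)%:R)%:E)%E]}.
  apply: (@choice _ _ (fun i V => [/\ open V, A i `<=` V &
    (inner_charge V <= outer_charge (A i) + (e / (2 ^ i.+1)%:R)%:E)%E])) => i.
  have e1 : 0 < e / (2 ^ i.+1)%:R by rewrite divr_gt0// ltr0n expn_gt0.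
  have [_ [V [oV AV] <-] /ltW Vle] := lb_ereal_inf_adherent e1 (outer_fin (A i)).
  by exists V.
have oU : open (\bigcup_i U i) by apply: bigcup_open => i _; case: (UP i).
apply: (@le_trans _ _ (inner_charge (\bigcup_i U i))).
  rewrite -outer_open//; apply: outer_mono => x [i _ Aix].
  by exists i => //; case: (UP i) => _ + _; exact.
apply: le_trans (inner_bigcup (fun i => let: And3 o _ _ := UP i in o)) _.
by apply: lee_nneseries => // i _; case: (UP i).
Qed.

HB.instance Definition _ := isOuterMeasure.Build R T outer_charge
  outer0 outer_ge0 outer_mono outer_sigma_subadditive.

Let open_caratheodory U : open U -> outer_charge.-caratheodory U.
Proof.
move=> oU; apply: le_caratheodory_measurable => X.
apply: le_ereal_inf_tmp => _ [W [oW XW] <-].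
have oWU : open (W `&` U) by exact: openI.
apply: (@le_trans _ _ (inner_charge (W `&` U) + outer_charge (W `&` ~` U))%E).
  by rewrite -(outer_open oWU); apply: leeD; apply: outer_mono; exact: setSI.
rewrite -leeBrDr//; apply: ge_ereal_sup => _ [C [cC CWU] <-].
rewrite leeBrDr//.
have oWC : open (W `&` ~` C).
  by apply: openI => //; apply: closed_openC; exact: compact_closed.
apply: (@le_trans _ _ ((m C)%:E + inner_charge (W `&` ~` C))%E).
  rewrite leeD2l// -(outer_open oWC); apply: outer_mono.
  by move=> x [Wx nUx]; split=> // /CWU[].
rewrite addeC -leeBrDr//; apply: ge_ereal_sup => _ [C' [cC' C'WC] <-].
rewrite leeBrDr// -EFinD addrC -mU.
  apply: inner_ub; first exact: compactU.
  by move=> x [/CWU[]|/C'WC[]].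
by rewrite -subset0 => x [Cx /C'WC[]].
Qed.

Let borel_caratheodory (A : set (borel T)) : measurable A ->
  outer_charge.-caratheodory A.
Proof.
move: A; apply: smallest_sub; last by move=> U; exact: open_caratheodory.
split=> [|B mB|F mF].
- exact: caratheodory_measurable_set0.
- by rewrite setTD; exact: caratheodory_measurable_setC.
- exact: caratheodory_measurable_bigcup.
Qed.

Let outer_sigma_additive : semi_sigma_additive (outer_charge : set (borel T) -> \bar R).
Proof.
move=> F mF tF mUF.
apply: (@caratheodory_measure_sigma_additive R T outer_charge) => //.
- by move=> i; exact: borel_caratheodory.
- exact: borel_caratheodory.
Qed.

HB.instance Definition _ := isMeasure.Build _ (borel T) R
  (outer_charge : set (borel T) -> \bar R) outer0 outer_ge0 outer_sigma_additive.

(** Tightness prevents the approximation by compact sets from losing mass. *)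
Let outerT : outer_charge [set: borel T] = 1%E.
Proof.
apply/eqP; rewrite eq_le outer_le1/= outer_open; last exact: openT.
apply/lee_addgt0Pr => e e0; have [C cC mC] := m_tight e0.
by rewrite -leeBlDr//; apply: le_trans (inner_ub cC _).
Qed.

HB.instance Definition _ := Measure_isProbability.Build _ (borel T) R
  (outer_charge : set (borel T) -> \bar R) outerT.

(** Only an inequality survives on open sets: a finitely additive [m] may give [U] more than the
    supremum over its compact subsets. *)
Theorem tight_charge_measure :
  exists P : probability (borel T) R,
    forall U, open U -> (P U <= (m U)%:E)%E.
Proof.
exists (outer_charge : set (borel T) -> \bar R) => U oU.
by apply: le_trans (inner_charge_le U); rewrite -(outer_open oU).
Qed.

End inner_compact_measure.

(** * Mean functionals *)

Section mean_functionals.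
Context {R : realType}.

(** The sum counts the integers from 1 to [n] strictly below [y]. With [le_sum_lt] it gives the two
    pointwise bounds of the layer cake. *)
Lemma sum_lt_le (y : R) n : 0 <= y -> \sum_(i < n) (i.+1%:R < y)%R%:R <= y.
Proof.
move=> y0; elim: n => [|n IH]; first by rewrite big_ord0.
rewrite big_ord_recr/=; have [ny|ny] := ltP; last by rewrite addr0.
apply: (@le_trans _ _ (n%:R + 1)); last by rewrite natr1 ltW.
rewrite lerD2r; apply: (@le_trans _ _ (\sum_(i < n) 1)).
  by apply: ler_sum => i _; rewrite lern1 leq_b1.
by rewrite sumr_const card_ord.
Qed.

Lemma le_sum_lt (y : R) n : y <= n.+1%:R ->
  y <= 1 + \sum_(i < n) (i.+1%:R < y)%R%:R.
Proof.
elim: n y => [|n IH] y yn; first by rewrite big_ord0 addr0.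
have [ny|ny] := leP y n.+1%:R.
  apply: (le_trans (IH _ ny)); rewrite lerD2l big_ord_recr/= lerDl.
  by rewrite ler0n.
apply: (le_trans yn); rewrite -nat1r lerD2l.
rewrite (eq_bigr (fun=> 1)) ?sumr_const ?card_ord// => i _.
by rewrite (le_lt_trans _ ny)// ler_nat.
Qed.

(** A normalized positive linear functional. The domain [B] lets one notion cover integrals of
    bounded measurable functions and finitely additive means of all bounded functions. *)
Definition mean_on (T : Type) (B : set (T -> R)) (E : (T -> R) -> R) :=
  [/\ forall f g, B f -> B g -> E (fun x => f x + g x) = E f + E g,
      forall c f, B f -> E (fun x => c * f x) = c * E f,
      forall f g, B f -> B g -> (forall x, f x <= g x) -> E f <= E g
    & E (fun=> 1) = 1].

Definition lower_semicontinuous_fct (T : topologicalType) (g : T -> R) :=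
  forall c, open [set x | c < g x].

(* Layer cake: with S = sum_(i < n) 1_{k g > i + 1} one has
   S <= k g <= 1 + S as soon as 0 <= k g <= n + 1. *)
Lemma lsc_mean_le (T : topologicalType) (B : set (T -> R)) E1 E2 :
  (forall f g, B f -> B g -> B (fun x => f x + g x)) ->
  (forall c f, B f -> B (fun x => c * f x)) ->
  B (fun=> 1) -> (forall U, open U -> B \1_U) ->
  mean_on B E1 -> mean_on B E2 ->
  (forall U, open U -> E1 \1_U <= E2 \1_U) ->
  forall g, B g -> (exists M, forall x, `|g x| <= M) ->
    lower_semicontinuous_fct g -> E1 g <= E2 g.
Proof.
move=> BD BZ B1 BU [D1 Z1 M1 E11] [D2 Z2 M2 E21] leU g Bg [M gM] lscg.
(* The shift by [M] makes the function nonnegative and moves both means equally; [M * 1] has the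
   shape of the scaling law. *)
pose G x := g x + M * 1.
have BM : B (fun=> M * 1) := BZ M _ B1.
have BG : B G := BD _ _ Bg BM.
have EG1 : E1 G = E1 g + M.
  by rewrite (D1 g (fun=> M * 1))// (Z1 M (fun=> 1))// E11 mulr1.
have EG2 : E2 G = E2 g + M.
  by rewrite (D2 g (fun=> M * 1))// (Z2 M (fun=> 1))// E21 mulr1.
(* The layer cake is off by 1. Applied to k g, it is off by 1 / k after division, and [k] is
   arbitrary. *)
suff key (k : nat) : (0 < k)%N -> k%:R * E1 G <= 1 + k%:R * E2 G.
  rewrite -(lerD2r M) -EG1 -EG2; apply/ler_addgt0Pr => e e0.
  pose k := (Num.trunc e^-1).+1.
  have k0 : 0 < k%:R :> R by rewrite ltr0n.
  rewrite -(ler_pM2l k0) (le_trans (key k isT))//.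
  by rewrite mulrDr addrC lerD2l -ler_pdivrMr// mul1r ltW// truncnS_gt.
move=> k0; have [n nk] : exists n : nat, k%:R * (M + M) <= n.+1%:R.
  exists (Num.trunc (k%:R * (M + M))); exact/ltW/truncnS_gt.
have G0 x : 0 <= k%:R * G x.
  by rewrite mulr_ge0// /G; have := gM x; rewrite ler_norml; lra.
have Gn x : k%:R * G x <= n.+1%:R.
  apply: le_trans nk; rewrite ler_wpM2l// /G.
  by have := gM x; rewrite ler_norml; lra.
pose U i := [set x | i.+1%:R < k%:R * G x].
have oU i : open (U i).
  have -> : U i = [set x | i.+1%:R / k%:R - M < g x].
    apply/seteqP; split=> x; rewrite /U/G/=;
      by rewrite ltrBlDr ltr_pdivrMr ?ltr0n// mulr1 mulrC.
  exact: lscg.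
pose S j x := \sum_(i < j) (\1_(U i) x : R).
have S0 : S 0 = (fun=> 0 * 1) by apply/funext => x; rewrite /S big_ord0 mul0r.
have Srec j : S j.+1 = (fun x => S j x + \1_(U j) x).
  by apply/funext => x; rewrite /S big_ord_recr.
have [BS leS] : B (S n) /\ E1 (S n) <= E2 (S n).
  elim: (n) => [|j [BSj leSj]].
    rewrite S0; split; first exact: (BZ 0).
    by rewrite (Z1 0 (fun=> 1))// (Z2 0 (fun=> 1))// E11 E21.
  have BUj := BU _ (oU j).
  by rewrite Srec; split; [exact: BD BSj BUj|rewrite D1// D2// lerD// leU].
have SE x : S n x = \sum_(i < n) (i.+1%:R < k%:R * G x)%R%:R.
  apply: eq_bigr => i _; rewrite indicE; congr (_%:R).
  by congr nat_of_bool; apply/idP/idP; rewrite inE.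
rewrite -(Z1 _ G)// -(Z2 _ G)//; apply: (@le_trans _ _ (1 + E2 (S n))).
  apply: (@le_trans _ _ (1 + E1 (S n))); last by rewrite lerD2l.
  have <- : E1 (fun x => 1 + S n x) = 1 + E1 (S n).
    by rewrite (D1 (fun=> 1))// E11.
  apply: M1; [exact: (BZ _ G)|exact: BD B1 BS|].
  by move=> x; rewrite SE; exact: le_sum_lt.
rewrite lerD2l; apply: M2 => //; first exact: (BZ _ G).
by move=> x; rewrite SE; exact: sum_lt_le.
Qed.

End mean_functionals.

Section borel_means.
Context {R : realType} {T : ptopologicalType}.

Lemma lsc_borel_measurable (g : T -> R) :
  lower_semicontinuous_fct g -> measurable_fun [set: borel T] g.
Proof.
move=> lg; apply: (measurability _ (RGenOInfty.measurableE R)).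
move=> _ [_ [c ->] <-]; rewrite setTI; apply: sub_sigma_algebra.
by rewrite (_ : _ @^-1` _ = [set x | c < g x])//; apply/seteqP; split=> x;
  rewrite /= in_itv/= andbT.
Qed.

Lemma continuous_lsc (g : T -> R) :
  continuous g -> lower_semicontinuous_fct g.
Proof.
move=> cg c; rewrite (_ : mkset _ = g @^-1` [set y | c < y])//.
by move/continuousP : cg; apply; exact: open_gt.
Qed.

Lemma continuous_borel_measurable (g : T -> R) :
  continuous g -> measurable_fun [set: borel T] g.
Proof. by move=> cg; apply: lsc_borel_measurable; exact: continuous_lsc. Qed.

Lemma open_borel_measurable (U : set T) :
  open U -> measurable (U : set (borel T)).
Proof. by move=> oU; exact: sub_sigma_algebra. Qed.

End borel_means.

(** * Bounded functions and the representation of tight means *)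

Section bounded_means.
Context {R : realType}.

Definition bounded_fct (T : Type) (f : T -> R) := exists M, forall x, `|f x| <= M.

Lemma bounded_fctD (T : Type) (f g : T -> R) :
  bounded_fct f -> bounded_fct g -> bounded_fct (fun x => f x + g x).
Proof.
move=> [M fM] [N gN]; exists (M + N) => x.
by apply: le_trans (ler_normD _ _) _; exact: lerD.
Qed.

Lemma bounded_fctZ (T : Type) c (f : T -> R) :
  bounded_fct f -> bounded_fct (fun x => c * f x).
Proof. by move=> [M fM]; exists (`|c| * M) => x; rewrite normrM ler_wpM2l. Qed.

Lemma bounded_fct_cst (T : Type) c : bounded_fct (fun _ : T => c).
Proof. by exists `|c|. Qed.

Lemma bounded_fct_indic (T : Type) (A : set T) : bounded_fct (\1_A : T -> R).
Proof.
by exists 1 => x; rewrite indicE ger0_norm ?ler0n// lern1 leq_b1.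
Qed.

Lemma bounded_fct_integrable d (T : measurableType d)
    (P : {finite_measure set T -> \bar R}) (f : T -> R) :
  measurable_fun setT f -> bounded_fct f -> P.-integrable setT (EFin \o f).
Proof.
move=> mf [M fM]; apply: measurable_bounded_integrable => //.
  by rewrite -ge0_fin_numE//; exact: fin_num_measure.
exists M; split; first exact: num_real.
by move=> N MN x _; apply: le_trans (ltW MN).
Qed.

Definition bounded_measurable d (T : measurableType d) : set (T -> R) :=
  [set f | measurable_fun setT f /\ bounded_fct f].

Lemma Rintegral_mean d (T : measurableType d) (P : probability T R) :
  mean_on (@bounded_measurable d T) (fun f => \int[P]_x f x).
Proof.
have I f : bounded_measurable f -> P.-integrable setT (EFin \o f).
  by move=> [mf bf]; exact: bounded_fct_integrable.
split=> [f g Bf Bg|c f Bf|f g Bf Bg fg|].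
- by rewrite RintegralD//; exact: I.
- by rewrite RintegralZl//; exact: I.
- by apply: le_Rintegral => //; exact: I.
- have PT := @probability_setT _ _ _ P.
  by rewrite Rintegral_cst// [X in fine X]PT mulr1.
Qed.

Lemma Rintegral_indic d (T : measurableType d) (P : probability T R) A :
  measurable A -> (\int[P]_x \1_A x)%:E = P A.
Proof.
move=> mA; rewrite /Rintegral integral_indic// setIT fineK//.
exact: fin_num_measure.
Qed.

(** The measure lies below E on open sets, and [lsc_mean_le] carries this over to lower
    semicontinuous functions. For bounded continuous [g] the bounds for [g] and its negative
    together give equality. *)
Theorem tight_mean_representation (T : ptopologicalType)
    (E : (T -> R) -> R) : @cozero_opens R T -> hausdorff_space T ->
  mean_on (@bounded_fct T) E ->
  (forall e, 0 < e -> exists2 C, compact C & 1 - e <= E \1_C) ->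
  exists P : probability (borel T) R, forall g, bounded_fct g ->
    lower_semicontinuous_fct g -> \int[P]_x g x <= E g.
Proof.
move=> cT hT [ED EZ EM E1] tight.
have BI (A : set T) : bounded_fct (\1_A : T -> R) by exact: bounded_fct_indic.
have E0 : E (fun=> 0) = 0.
  by have := EZ 0 _ (bounded_fct_cst T 1); rewrite !mul0r.
have [||||P PU] := @tight_charge_measure R T cT hT (fun A => E \1_A).
- move=> A; rewrite -E0.
  apply: EM; [exact: bounded_fct_cst|exact: BI|by move=> x; rewrite indicE].
- move=> A B AB; rewrite -ED//; congr E; apply/funext => x.
  rewrite !indicE in_setU; have [xA|] /= := boolP (x \in A); rewrite ?add0r//.
  have -> : x \in B = false; last by rewrite addr0.
  apply/negP => xB; suff : set0 x by [].
  by rewrite -AB; split; exact/set_mem.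
- by rewrite -E1; congr E; apply/funext => x; rewrite indicT.
- exact: tight.
exists P => g bg lg.
apply: (@lsc_mean_le _ T (@bounded_measurable _ (borel T))
  (fun f => \int[P]_x f x)) => //.
- move=> f1 f2 [m1 b1] [m2 b2]; split; last exact: bounded_fctD.
  exact: measurable_funD.
- move=> c f [mf bf]; split; last exact: bounded_fctZ.
  exact: measurable_funM.
- by split; [exact: measurable_cst|exact: bounded_fct_cst].
- move=> U oU; split; last exact: BI.
  by apply: measurable_indic; exact: open_borel_measurable.
- exact: (@Rintegral_mean _ _ P).
- by split=> // [f1 f2 [_ b1] [_ b2]|c f [_ bf]|f1 f2 [_ b1] [_ b2]];
    [exact: ED|exact: EZ|exact: EM].
- move=> U oU; rewrite -lee_fin Rintegral_indic; first exact: PU.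
  exact: open_borel_measurable.
- by split=> //; exact: lsc_borel_measurable.
Qed.

End bounded_means.

(** * Borel measures on spaces whose open sets are cozero *)

Section cozero_measures.
Context {R : realType} {T : ptopologicalType}.
Hypothesis T_cozero : @cozero_opens R T.

(* For U = {f > 0}, the functions min 1 (n f) increase to the indicator of U. *)
Theorem cozero_measure_unique (m1 m2 : {finite_measure set (borel T) -> \bar R}) :
  (forall h : T -> R, continuous h -> bounded_fct h ->
     \int[m1]_x h x = \int[m2]_x h x) ->
  forall B : set (borel T), measurable B -> m1 B = m2 B.
Proof.
move=> m12 B mB.
apply: (@measure_unique _ R (borel T) (@open T) (fun=> setT)) => //.
- by move=> U V; exact: openI.
- by move=> _; exact: openT.
- by rewrite bigcup_const//; exists 0.
- move=> _ /T_cozero[f [cf f0 ->]].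
  pose g n x := Num.min 1 (n%:R * f x).
  have cg n : continuous (g n).
    move=> x.
    have c1 : {for x, continuous (fun=> 1 : R^o)} by exact: cst_continuous.
    have c2 : {for x, continuous (fun x => n%:R * f x : R^o)}.
      by apply: (cvgM (cvg_cst _)); exact: cf.
    exact: continuous_min c1 c2.
  have g0 n x : 0 <= g n x by rewrite le_min ler01 mulr_ge0.
  have bg n : bounded_fct (g n).
    by exists 1 => x; rewrite ger0_norm// ge_min lexx.
  have mg n : measurable_fun [set: borel T] (g n).
    exact: continuous_borel_measurable.
  have cvg (m : {finite_measure set (borel T) -> \bar R}) :
      (\int[m]_x (g n x)%:E)%E @[n --> \oo] --> m [set x | 0 < f x].
    have gE x : (g n x)%:E @[n --> \oo] --> ((\1_[set x | 0 < f x] x)%:E : \bar R).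
      apply: cvg_near_cst; rewrite indicE.
      have [/set_mem/= fx|/negP fx] := boolP (x \in _); last first.
        have fxE : f x = 0.
          apply/eqP; rewrite eq_le f0 andbT leNgt; apply/negP => fx0.
          by apply: fx; exact/mem_set.
        by apply: nearW => n; rewrite /g fxE mulr0 min_r.
      near=> n; rewrite /g min_l// -ler_pdivrMr// mul1r.
      by near: n; exact: nbhs_infty_ger.
    have -> : m [set x | 0 < f x] =
        (\int[m]_x limn (fun n => (g n x)%:E : \bar R))%E.
      transitivity (\int[m]_x (\1_[set x | 0 < f x] x)%:E)%E.
        rewrite integral_indic ?setIT//; apply: open_borel_measurable.
        exact: continuous_lsc.
      by apply: eq_integral => x _; apply/esym/cvg_lim => //; exact: gE.
    apply: cvg_monotone_convergence => //.
    + by move=> n; exact/measurable_EFinP.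
    + by move=> n x _; rewrite lee_fin.
    + move=> x _ i j ij; rewrite lee_fin le_min !ge_min lexx/=.
      by rewrite ler_wpM2r ?ler_nat// orbT.
  apply: (cvg_unique _ (cvg m1)) => //.
  suff -> : (fun n => \int[m1]_x (g n x)%:E)%E =
            (fun n => \int[m2]_x (g n x)%:E)%E by exact: cvg.
  apply/funext => n.
  have I (m : {finite_measure set (borel T) -> \bar R}) :
      (\int[m]_x (g n x)%:E)%E = (\int[m]_x g n x)%:E.
    rewrite /Rintegral fineK//; apply: integrable_fin_num => //.
    exact: bounded_fct_integrable.
  by rewrite !I m12.
- by move=> _; rewrite -ge0_fin_numE//; exact: fin_num_measure.
Unshelve. all: by end_near. Qed.

Let small_tail (m : {finite_measure set (borel T) -> \bar R})
    (G : (set (borel T))^nat) (e : R) :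
  (forall n, measurable (G n)) -> nonincreasing_seq G ->
  (m (\bigcap_n G n) < e%:E)%E -> exists n, (m (G n) <= e%:E)%E.
Proof.
move=> mG dG Ge.
have fin (A : set (borel T)) : measurable A -> (m A < +oo)%E.
  by move=> mA; rewrite -ge0_fin_numE//; exact: fin_num_measure.
have mI : measurable (\bigcap_n G n) by exact: bigcap_measurable.
have /fine_cvgP[_ cv] : m (G n) @[n --> \oo] --> (fine (m (\bigcap_n G n)))%:E.
  rewrite fineK; last by rewrite fin_num_measure.
  by apply: nonincreasing_cvg_mu => //; exact: fin.
have Ge' : fine (m (\bigcap_n G n)) < e by rewrite -lte_fin fineK// fin_num_measure.
have [n _ /(_ n (leqnn n)) /= /ltW mGn] := cvgr_lt _ cv _ Ge'.
by exists n; rewrite -(@fineK _ (m (G n))) ?lee_fin// fin_num_measure.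
Qed.

(** The approximation is two-sided because this form is stable under complements. *)
Let regular (m : {finite_measure set (borel T) -> \bar R}) : set (set T) :=
  [set B | forall e : R, 0 < e -> exists F U, [/\ closed F, open U, F `<=` B,
    B `<=` U & (m (U `\` F : set (borel T)) <= e%:E)%E]].

Let closed_measurable (F : set T) : closed F -> measurable (F : set (borel T)).
Proof.
move=> cF; rewrite -[F]setCK; apply: measurableC.
by apply: open_borel_measurable; exact: closed_openC.
Qed.

(** The closed sets {f >= 1 / (n + 1)} increase to U = {f > 0}, so their complements in [U] have
    vanishing measure. *)
Let regular_open m U : open U -> regular m U.
Proof.
move=> oU e e0; have [f [cf f0 UE]] := T_cozero oU.
pose F n := [set x | n.+1%:R^-1 <= f x].
have cF n : closed (F n).
  by apply: (preimage_closed _ (@closed_ge _ _)) => y _; exact: cf.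
have [] := @small_tail m (fun n => U `\` F n) e.
- by move=> n; apply: measurableD;
    [exact: open_borel_measurable|exact: closed_measurable].
- move=> i j ij; apply/subsetPset => x [Ux nF]; split=> //; apply: contra_not nF.
  by apply: le_trans; rewrite lef_pV2 ?posrE ?ltr0n// ler_nat.
- rewrite (_ : \bigcap_n _ = set0) ?measure0// -subset0 => x Gx.
  have := Gx 0%N Logic.I; rewrite UE => -[/= fx _].
  have [_] := Gx (Num.trunc (f x)^-1) Logic.I; apply; rewrite /F/=.
  by rewrite invf_ple ?posrE ?ltr0n// ltW// truncnS_gt.
move=> n mn; exists (F n), U; split=> // x; rewrite UE/=.
by apply: lt_le_trans; rewrite invr_gt0 ltr0n.
Qed.

Let regular_sigma_algebra m : sigma_algebra setT (regular m).
Proof.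
split=> [e e0|B rB e e0|B rB e e0].
- exists set0, set0; split=> //; [exact: closed0|exact: open0|].
  by rewrite setDv measure0 lee_fin ltW.
- have [F [U [cF oU FB BU mUF]]] := rB e e0.
  exists (~` U), (~` F); split.
  + exact: open_closedC.
  + exact: closed_openC.
  + by rewrite setTD; exact: subsetC.
  + by rewrite setTD; exact: subsetC.
  + by rewrite setDE setCK setIC -setDE.
(* [small_tail] asks for a strict bound; the errors sum to at most e / 4, safely below [e]. *)
- have e2 : 0 < e / 2 / 2 by rewrite !divr_gt0.
  have [FU FUP] : {FU : (set T * set T)^nat & forall i, [/\ closed (FU i).1,
      open (FU i).2, (FU i).1 `<=` B i, B i `<=` (FU i).2 &
      (m ((FU i).2 `\` (FU i).1 : set (borel T)) <=
       (e / 2 / 2 / (2 ^ i.+1)%:R)%:E)%E]}.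
    apply: (@choice _ _ (fun i (x : set T * set T) => [/\ closed x.1, open x.2,
      x.1 `<=` B i, B i `<=` x.2 & (m (x.2 `\` x.1 : set (borel T)) <=
      (e / 2 / 2 / (2 ^ i.+1)%:R)%:E)%E])) => i.
    have [|F [U ?]] := rB i (e / 2 / 2 / (2 ^ i.+1)%:R); last by exists (F, U).
    by rewrite divr_gt0// ltr0n expn_gt0.
  pose U := \bigcup_i (FU i).2.
  pose F1 i := (FU i).1.
  (* The union of all the closed sets need not be closed; finite unions are, and [small_tail] finds
     one that loses little. *)
  pose F n := \big[setU/set0]_(i < n) F1 i.
  have cF n : closed (F n).
    rewrite /F; elim/big_ind : _ => [|? ? ? ?|i _];
      [exact: closed0|exact: closedU|by case: (FUP i)].
  have oU : open U by apply: bigcup_open => i _; case: (FUP i).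
  have mUF i : measurable ((FU i).2 `\` (FU i).1 : set (borel T)).
    case: (FUP i) => ? ? _ _ _; apply: measurableD;
      [exact: open_borel_measurable|exact: closed_measurable].
  have [] := @small_tail m (fun n => U `\` F n) e.
  + by move=> n; apply: measurableD;
      [exact: open_borel_measurable|exact: closed_measurable].
  + move=> i j ij; apply/subsetPset; apply: setDS.
    rewrite /F -!bigcup_mkord => x [k /= ki Fk].
    by exists k => //=; exact: leq_trans ij.
  + apply: (@le_lt_trans _ _ (e / 2)%:E); last first.
      by rewrite lte_fin ltr_pdivrMr// ltr_pMr// ltr1n.
    apply: (@le_trans _ _ (\sum_(i <oo) m ((FU i).2 `\` (FU i).1))%E).
      apply: measure_sigma_subadditive => //.
        by apply: bigcap_measurable => // n _; apply: measurableD;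
          [exact: open_borel_measurable|exact: closed_measurable].
      move=> x Gx; have [[i _ Uix] _] := Gx 0%N Logic.I.
      exists i => //; split=> // Fix.
      have [_] := Gx i.+1 Logic.I; apply.
      by rewrite /F -bigcup_mkord; exists i => /=.
    apply: (@le_trans _ _ (\sum_(i <oo) (0 + (e / 2 / 2 / (2 ^ i.+1)%:R)%:E))%E).
      apply: lee_nneseries => // i _; rewrite add0e.
      by case: (FUP i).
    apply: le_trans (epsilon_trick _ _ _) _ => //; first exact: ltW.
    rewrite eseries0// add0e lee_fin ler_pdivrMr// ler_peMr ?ler1n//.
    by rewrite divr_ge0// ltW.
  move=> n mn; exists (F n), U; split=> //.
    rewrite /F -bigcup_mkord => x [i _ Fix]; exists i => //.
    by case: (FUP i) => _ _ + _ _; apply.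
  move=> x [i _ Bix]; exists i => //.
  by case: (FUP i) => _ _ _ + _; apply.
Qed.

Theorem closed_inner_regular (m : {finite_measure set (borel T) -> \bar R})
    (B : set (borel T)) (e : R) : measurable B -> 0 < e ->
  exists2 F : set T, closed F & F `<=` B /\ (m (B `\` F) <= e%:E)%E.
Proof.
move=> mB e0.
have reg : <<s @open T >> `<=` regular m.
  apply: smallest_sub; [exact: regular_sigma_algebra|exact: regular_open].
have [F [U [cF oU FB BU mUF]]] := reg _ mB _ e0.
exists F => //; split=> //; apply: le_trans mUF; apply: le_measure; rewrite ?inE.
- by apply: measurableD => //; exact: closed_measurable.
- by apply: measurableD; [exact: open_borel_measurable|exact: closed_measurable].
- exact: setSD.
Qed.

End cozero_measures.

(** * Mixtures of kernels *)

Section integral_mixture.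
Context d1 d2 (X : measurableType d1) (Y : measurableType d2) (R : realType).
Variables (mu : {measure set X -> \bar R}) (Q : R.-ker X ~> Y)
  (nu : {measure set Y -> \bar R}).
Hypothesis nuE : forall B, measurable B -> nu B = (\int[mu]_x Q x B)%E.

Import HBNNSimple.
Local Open Scope ereal_scope.

Let nnsfun_mixture (f : {nnsfun Y >-> R}) :
  \int[nu]_y (f y)%:E = \int[mu]_x \int[Q x]_y (f y)%:E.
Proof.
rewrite integralT_nnsfun sintegralE.
under [RHS]eq_integral do rewrite integralT_nnsfun sintegralE.
have mQ r : measurable_fun setT (fun x => Q x (f @^-1` [set r])).
  exact: measurable_kernel.
rewrite ge0_integral_fsum//; last 2 first.
- by move=> r; exact: measurable_funeM.
- move=> r x _; apply: (mulemu_ge0 (fun r => f @^-1` [set r])).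
  exact: preimage_nnfun0.
apply: eq_fsbigr => r _; rewrite nuE//; have [r0|r0] := leP 0%R r.
  by rewrite ge0_integralZl.
rewrite preimage_nnfun0//; under eq_integral do rewrite measure0.
by under [RHS]eq_integral do rewrite measure0 mule0; rewrite !integral0 mule0.
Qed.

Lemma ge0_integral_mixture (f : Y -> \bar R) : (forall y, 0 <= f y) ->
  measurable_fun setT f -> \int[nu]_y f y = \int[mu]_x \int[Q x]_y f y.
Proof.
move=> f0 mf; pose f_ := nnsfun_approx measurableT mf.
have f_cvg y : (f_ n y)%:E @[n --> \oo] --> f y by exact: cvg_nnsfun_approx.
have limE (m : {measure set Y -> \bar R}) :
    \int[m]_y f y = limn (fun n => \int[m]_y (f_ n y)%:E).
  rewrite -monotone_convergence//; last 3 first.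
  - by move=> n; exact/measurable_EFinP.
  - by move=> n y _; rewrite lee_fin.
  - by move=> y _ i j ij; rewrite lee_fin; exact/lefP/nd_nnsfun_approx.
  by apply: eq_integral => y _; apply/esym/cvg_lim => //; exact: f_cvg.
rewrite limE; under eq_fun do rewrite nnsfun_mixture.
rewrite -monotone_convergence//; last 3 first.
- move=> n; apply: measurable_fun_integral_kernel => //.
  + by move=> U mU; exact: measurable_kernel.
  + by move=> y; rewrite lee_fin.
  + exact/measurable_EFinP.
- by move=> n x _; apply: integral_ge0 => y _; rewrite lee_fin.
- move=> x _ i j ij; apply: ge0_le_integral => //.
  + by move=> y _; rewrite lee_fin.
  + exact/measurable_EFinP.
  + exact/measurable_EFinP.
  + by move=> y _; rewrite lee_fin; exact/lefP/nd_nnsfun_approx.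
by apply: eq_integral => x _; rewrite limE.
Qed.

Local Close Scope ereal_scope.

Let ge0_Rintegral_mixture (h : Y -> R) : (forall y, 0 <= h y) ->
  nu.-integrable setT (EFin \o h) ->
  (forall x, (Q x).-integrable setT (EFin \o h)) ->
  mu.-integrable setT (fun x => (\int[Q x]_y h y)%:E) /\
  \int[nu]_y h y = \int[mu]_x \int[Q x]_y h y.
Proof.
move=> h0 ih iQ; have mh := measurable_int _ ih.
have QE x : (\int[Q x]_y h y)%:E = (\int[Q x]_y (h y)%:E)%E.
  by rewrite /Rintegral fineK//; exact: integrable_fin_num (iQ x).
have mixE : (\int[mu]_x (\int[Q x]_y h y)%:E = \int[nu]_y (h y)%:E)%E.
  under eq_integral do rewrite QE.
  by rewrite ge0_integral_mixture// => y; rewrite lee_fin.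
split; last by rewrite {1}/Rintegral -mixE.
apply/integrableP; split.
  under eq_fun do rewrite QE; apply: measurable_fun_integral_kernel => //.
  by move=> U mU; exact: measurable_kernel.
under eq_integral do rewrite gee0_abs ?lee_fin ?Rintegral_ge0//.
by rewrite mixE -ge0_fin_numE ?integral_ge0// => [|y _];
  [exact: integrable_fin_num ih|rewrite lee_fin].
Qed.

Lemma Rintegral_mixture (h : Y -> R) : nu.-integrable setT (EFin \o h) ->
  (forall x, (Q x).-integrable setT (EFin \o h)) ->
  mu.-integrable setT (fun x => (\int[Q x]_y h y)%:E) /\
  \int[nu]_y h y = \int[mu]_x \int[Q x]_y h y.
Proof.
move=> ih iQ.
(* Integrability under every [Q x] allows the inner integrals of the positive and negative parts to
   be subtracted. *)
pose hp y := Num.max (h y) 0; pose hn y := Num.max (- h y) 0.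
have hE : h = (fun y => hp y - hn y).
  by apply/funext => y; rewrite /hp/hn/Num.max; do 2 case: ltP => ?; lra.
have int d (T : measurableType d) (m : {measure set T -> \bar R}) (k : T -> R) :
    m.-integrable setT (EFin \o k) ->
    m.-integrable setT (EFin \o (fun y => Num.max (k y) 0)).
  move=> ik; have /measurable_EFinP mk := measurable_int _ ik.
  apply: le_integrable ik => //.
    by apply/measurable_EFinP; apply: measurable_maxr => //; exact: measurable_cst.
  move=> y _; rewrite lee_fin /Num.max; case: ltP => // _.
  by rewrite normr0.
have intN d (T : measurableType d) (m : {measure set T -> \bar R}) (k : T -> R) :
    m.-integrable setT (EFin \o k) -> m.-integrable setT (EFin \o (fun y => - k y)).
  by move=> ik; have := integrableN ik; apply: eq_integrable.
have hp0 y : 0 <= hp y by rewrite le_max lexx orbT.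
have hn0 y : 0 <= hn y by rewrite le_max lexx orbT.
have iQp x : (Q x).-integrable setT (EFin \o hp) by exact: int.
have iQn x : (Q x).-integrable setT (EFin \o hn).
  exact/(int _ _ _ (fun y => - h y))/intN.
have inp : nu.-integrable setT (EFin \o hp) by exact: int.
have inn : nu.-integrable setT (EFin \o hn).
  exact/(int _ _ _ (fun y => - h y))/intN.
have [ip ep] := ge0_Rintegral_mixture hp0 inp iQp.
have [in' en] := ge0_Rintegral_mixture hn0 inn iQn.
have QE : (fun x => \int[Q x]_y h y) =
          (fun x => \int[Q x]_y hp y - \int[Q x]_y hn y).
  by apply/funext => x; rewrite hE RintegralB.
split.
  have -> : (fun x => (\int[Q x]_y h y)%:E) =
      ((fun x => (\int[Q x]_y hp y)%:E) \- (fun x => (\int[Q x]_y hn y)%:E))%E.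
    by apply/funext => x; rewrite (congr1 (@^~ x) QE) EFinB.
  exact: integrableB.
by rewrite QE [in LHS]hE !RintegralB// ep en.
Qed.

End integral_mixture.

(** * Utility functions *)

Section finite_measure_add.
Context d (T : measurableType d) (R : realType).
Variables m1 m2 : {finite_measure set T -> \bar R}.

Definition finite_measure_add := measure_add m1 m2.

HB.instance Definition _ := Measure.on finite_measure_add.

Let finite_measure_add_fin : fin_num_fun finite_measure_add.
Proof.
move=> A mA; rewrite [X in X A]/finite_measure_add measure_addE fin_numD.
by rewrite !fin_num_measure.
Qed.

HB.instance Definition _ := Measure_isFinite.Build _ _ _ finite_measure_add
  finite_measure_add_fin.

End finite_measure_add.

Section utility.
Context {R : realType}.
Implicit Types (a b x eta : R) (u : R -> R) (L : {finite_measure set R -> \bar R}).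

(** The nonnegative counterpart of [neg_part], to which Tonelli's theorem and monotonicity of
    nonnegative integrals apply directly. *)
Definition shortfall x : R := - neg_part x.

Lemma shortfall_ge0 x : 0 <= shortfall x.
Proof. by rewrite oppr_ge0 /neg_part ge_min lexx orbT. Qed.

Lemma shortfall_le_norm x : shortfall x <= `|x|.
Proof.
rewrite /shortfall /neg_part /Num.min; case: ltP => x0; rewrite ?oppr0//.
by rewrite -normrN ler_norm.
Qed.

Lemma measurable_shortfall d (T : measurableType d) (f : T -> R) :
  measurable_fun setT f -> measurable_fun setT (fun t => shortfall (f t)).
Proof.
move=> mf; apply: (measurableT_comp (@oppr_measurable R setT)).
exact: (measurable_minr mf (measurable_cst (0 : R))).
Qed.

(** The bridge from the real-valued integral in [utility] to a nonnegative extended integral. It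
    rests on the boundedness of the integrand on [a, b]. *)
Lemma shortfall_intervalE a b L x :
  (- (\int[L]_(eta in `[a, b]) neg_part (x - eta)))%:E =
  (\int[L]_(eta in `[a, b]) (shortfall (x - eta))%:E)%E.
Proof.
have int : L.-integrable `[a, b] (EFin \o (fun eta => shortfall (x - eta))).
  apply: measurable_bounded_integrable => //.
  - by rewrite -ge0_fin_numE//; exact: fin_num_measure.
  - apply: measurable_funTS; apply: measurable_shortfall.
    by apply: measurable_funB => //; exact: measurable_cst.
  exists (`|x| + (`|a| + `|b|)); split; first exact: num_real.
  move=> M hM eta /=; rewrite in_itv/= => /andP[ae eb].
  apply: le_trans (ltW hM); rewrite ger0_norm ?shortfall_ge0//.
  apply: le_trans (shortfall_le_norm _) _; apply: le_trans (ler_normB _ _) _.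
  by rewrite lerD2l ler_norml; have := ler_norm b; have := ler_norm (- a);
    have := normr_ge0 a; have := normr_ge0 b; rewrite normrN; lra.
have -> : (\int[L]_(eta in `[a, b]) neg_part (x - eta)) =
    - (\int[L]_(eta in `[a, b]) shortfall (x - eta)).
  rewrite /Rintegral -fineN -integral_ge0N; last first.
    by move=> eta _; rewrite lee_fin shortfall_ge0.
  by congr fine; apply: eq_integral => eta _; rewrite /shortfall EFinN oppeK.
by rewrite opprK /Rintegral fineK//; exact: integrable_fin_num int.
Qed.

Lemma measurable_integral_shortfall d (T : measurableType d)
    (nu : {finite_measure set T -> \bar R}) (f : T -> R) :
  measurable_fun setT f ->
  measurable_fun setT (fun eta => \int[nu]_t (shortfall (f t - eta))%:E)%E.
Proof.
move=> mf.
pose k (p : T * R) : \bar R := (shortfall (f p.1 - p.2))%:E.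
have mk : measurable_fun setT k.
  apply/measurable_EFinP; apply: measurable_shortfall.
  apply: measurable_funB; last exact: measurable_snd.
  by apply: measurableT_comp => //; exact: measurable_fst.
have k0 p : (0 <= k p)%E by rewrite lee_fin shortfall_ge0.
exact: (measurable_fun_fubini_tonelli_G (m1 := nu) k mk k0).
Qed.

Section fubini.
Context d (T : measurableType d) (nu : {finite_measure set T -> \bar R}).
Variables (a b : R) (L : {finite_measure set R -> \bar R}) (u : R -> R).
Hypothesis uE : forall x, u x = \int[L]_(eta in `[a, b]) neg_part (x - eta).
Variables (f : T -> R) (mf : measurable_fun setT f).

(** The indicator encodes the restriction to [a, b], since Tonelli's theorem is applied on the full
    product. *)
Let K (p : T * R) : \bar R :=
  (shortfall (f p.1 - p.2) * \1_(`[a, b] : set R) p.2)%:E.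

Let K0 p : (0 <= K p)%E.
Proof. by rewrite lee_fin mulr_ge0 ?shortfall_ge0// indicE ler0n. Qed.

Let mK : measurable_fun setT K.
Proof.
apply/measurable_EFinP; apply: measurable_funM.
  apply: measurable_shortfall; apply: measurable_funB; last exact: measurable_snd.
  by apply: measurableT_comp => //; exact: measurable_fst.
have m1 : measurable_fun setT (\1_(`[a, b] : set R) : R -> R).
  exact: measurable_indic.
exact: (measurableT_comp m1 measurable_snd).
Qed.

Let KL t : (\int[L]_eta K (t, eta) = (- u (f t))%:E)%E.
Proof.
rewrite uE shortfall_intervalE [RHS]integral_mkcond.
apply: eq_integral => eta _; rewrite /K/= patchE indicE.
by case: ifPn => _; rewrite ?mulr1 ?mulr0.
Qed.

(** As [u] is known only as an integral against [L], measurability is taken from Tonelli's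
    theorem. *)
Lemma measurable_utility_comp : measurable_fun setT (u \o f).
Proof.
have : measurable_fun setT (fun t => (- u (f t))%:E).
  under eq_fun do rewrite -KL.
  exact: (measurable_fun_fubini_tonelli_F (m2 := L) K mK K0).
move=> /measurable_EFinP mu; have := measurableT_comp (@oppr_measurable R setT) mu.
by apply: eq_measurable_fun => t _ /=; rewrite opprK.
Qed.

Lemma utility_fubini : (\int[nu]_t (- u (f t))%:E =
  \int[L]_(eta in `[a, b]) \int[nu]_t (shortfall (f t - eta))%:E)%E.
Proof.
under eq_integral do rewrite -KL.
rewrite (fubini_tonelli (m1 := nu) (m2 := L) K mK K0) [RHS]integral_mkcond.
apply: eq_integral => eta _; rewrite patchE /K/= indicE; case: ifPn => _.
  by under eq_integral do rewrite mulr1.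
by under eq_integral do rewrite mulr0; rewrite integral0.
Qed.

End fubini.

Lemma utility_le0 a b u x : utility a b u -> u x <= 0.
Proof.
move=> [L uE]; rewrite -oppr_ge0 -lee_fin uE shortfall_intervalE.
by apply: integral_ge0 => eta _; rewrite lee_fin shortfall_ge0.
Qed.

Lemma utility_bounded a b u (M : R) : utility a b u ->
  exists C, forall x, `|x| <= M -> `|u x| <= C.
Proof.
move=> uu; have [L uE] := uu.
pose B := M + (`|a| + `|b|); exists (fine (B%:E * L [set` `[a, b]])%E) => x xM.
rewrite ler0_norm ?(utility_le0 _ uu)// -lee_fin fineK; last first.
  by rewrite fin_numM// fin_num_measure.
rewrite uE shortfall_intervalE -integral_cst//; apply: ge0_le_integral => //.
- by move=> eta _; rewrite lee_fin shortfall_ge0.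
- apply/measurable_EFinP; apply: measurable_funTS; apply: measurable_shortfall.
  by apply: measurable_funB => //; exact: measurable_cst.
- move=> eta /=; rewrite in_itv/= => /andP[ae eb]; rewrite lee_fin.
  apply: le_trans (shortfall_le_norm _) _; apply: le_trans (ler_normB _ _) _.
  apply: lerD => //.
  by rewrite ler_norml; have := ler_norm b; have := ler_norm (- a);
    have := normr_ge0 a; have := normr_ge0 b; rewrite normrN; lra.
Qed.

Lemma utility_comp_integrable d (T : measurableType d)
    (nu : {finite_measure set T -> \bar R}) a b u (f : T -> R) (M : R) :
  utility a b u -> measurable_fun setT f ->
  {ae nu, forall t, `|f t| <= M} -> nu.-integrable setT (EFin \o (u \o f)).
Proof.
move=> uu mf fM; have [C uC] := utility_bounded M uu; have [L uE] := uu.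
have muf : measurable_fun setT (u \o f) by exact: (measurable_utility_comp uE mf).
apply/integrableP; split; first exact/measurable_EFinP.
apply: (@le_lt_trans _ _ (\int[nu]_t (`|C|%:E))%E).
  apply: ae_ge0_le_integral => //.
  - by apply: measurableT_comp => //; exact/measurable_EFinP.
  - apply: filterS fM => t fxM _; rewrite /= lee_fin.
    by apply: le_trans (uC _ fxM) _; exact: ler_norm.
rewrite integral_cst// ltey_eq fin_numM// fin_num_measure//.
Qed.

Lemma utilityZ a b u c : 0 <= c -> utility a b u ->
  utility a b (fun x => c * u x).
Proof.
move=> c0 [L uE]; exists (mscale (NngNum c0) L) => x.
apply: oppr_inj; apply: EFin_inj; rewrite shortfall_intervalE.
rewrite ge0_integral_mscale//; last 2 first.
- apply/measurable_EFinP; apply: measurable_funTS; apply: measurable_shortfall.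
  by apply: measurable_funB => //; exact: measurable_cst.
- by move=> eta _; rewrite lee_fin shortfall_ge0.
by rewrite -shortfall_intervalE -uE -EFinM/= mulrN.
Qed.

Lemma utilityD a b u v : utility a b u -> utility a b v ->
  utility a b (fun x => u x + v x).
Proof.
move=> [L uE] [M vE].
exists (finite_measure_add L M) => x; apply: oppr_inj; apply: EFin_inj.
rewrite shortfall_intervalE.
rewrite ge0_integral_measure_add//; last 2 first.
- by move=> eta _; rewrite lee_fin shortfall_ge0.
- apply/measurable_EFinP; apply: measurable_funTS; apply: measurable_shortfall.
  by apply: measurable_funB => //; exact: measurable_cst.
by rewrite -!shortfall_intervalE -uE -vE -EFinD opprD.
Qed.

Lemma utility_neg_part a b eta : a <= eta <= b ->
  utility a b (fun x => neg_part (x - eta)).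
Proof.
move=> ab; exists (\d_eta : {finite_measure set R -> \bar R}) => x.
apply: oppr_inj; apply: EFin_inj; rewrite shortfall_intervalE integral_dirac//.
  by rewrite diracE mem_set ?mul1e//= in_itv.
apply/measurable_EFinP; apply: measurable_funTS; apply: measurable_shortfall.
by apply: measurable_funB => //; exact: measurable_cst.
Qed.

End utility.

(** * Weak duality *)

Section topology_of_pairs.

Lemma induced_comp (T U V : topologicalType) (f : T -> U) (g : U -> V) :
  induced_by f -> induced_by g -> induced_by (g \o f).
Proof.
move=> fi gi B; split=> [/fi[W /gi[W' oW' <-] <-]|[W oW <-]]; first by exists W'.
by apply/fi; exists (g @^-1` W) => //; apply/gi; exists W.
Qed.

Lemma induced_prod (T U X Y : topologicalType) (f : T -> X) (g : U -> Y) :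
  induced_by f -> induced_by g ->
  induced_by (fun p : T * U => (f p.1, g p.2)).
Proof.
move=> fi gi; set e := fun p => _.
have ce : continuous e.
  move=> p; apply: cvg_pair.
    apply: (@continuous_comp _ _ _ fst f); first exact: cvg_fst.
    exact: (induced_continuous fi).
  apply: (@continuous_comp _ _ _ snd g); first exact: cvg_snd.
  exact: (induced_continuous gi).
move=> B; split=> [oB|[W oW <-]]; last by move/continuousP : ce; exact.
(* This is the largest open set whose preimage lies in [B]. A box around each point of [B] shows
   that the preimage is all of [B]. *)
exists (\bigcup_(W in [set W | open W /\ e @^-1` W `<=` B]) W).
  by apply: bigcup_open => W [].
apply/seteqP; split=> [p [W [_ WB]]|p Bp]; first exact: WB.
have [[U1 U2] /= [nU1 nU2] U12B] : nbhs p B by exact: open_nbhs_nbhs.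
move: nU1 nU2; rewrite !nbhsE => -[V1 [oV1 V1p] V1U] [V2 [oV2 V2p] V2U].
have [W1 oW1 W1E] := (fi V1).1 oV1; have [W2 oW2 W2E] := (gi V2).1 oV2.
exists (W1 `*` W2); last first.
  by split; rewrite /e/=; [rewrite -W1E in V1p|rewrite -W2E in V2p].
split.
  rewrite openE => q [q1 q2]; exists (W1, W2) => //.
  by split; apply: open_nbhs_nbhs.
move=> q [/= q1 q2]; apply: U12B; split=> /=.
  by apply: V1U; rewrite -W1E.
by apply: V2U; rewrite -W2E.
Qed.

Context {R : realType} {S A : ptopologicalType} {D : action_map S A}.

Lemma borel_space_cozero_opens (T : topologicalType) :
  borel_space R T -> @cozero_opens R T.
Proof.
move=> [X [f [_ _ fi _]]]; apply: (induced_cozero_opens fi).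
exact: pseudometric_cozero_opens.
Qed.

Lemma borel_space_hausdorff (T : topologicalType) :
  borel_space R T -> hausdorff_space T.
Proof.
move=> [X [f [_ finj fi _]]]; apply: (induced_hausdorff fi finj).
exact: metric_hausdorff.
Qed.

Lemma set_val_induced : induced_by (fun k : pairs D => set_val k : S * A).
Proof. by []. Qed.

Lemma continuous_state : continuous (@state S A D).
Proof.
move=> k; apply: (@continuous_comp _ (S * A)%type S (fun k => set_val k) fst).
  exact: (induced_continuous set_val_induced).
exact: cvg_fst.
Qed.

Lemma continuous_action : continuous (@action S A D).
Proof.
move=> k; apply: (@continuous_comp _ (S * A)%type A (fun k => set_val k) snd).
  exact: (induced_continuous set_val_induced).
exact: cvg_snd.
Qed.

Lemma pairs_cozero_opens : borel_space R S -> borel_space R A ->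
  @cozero_opens R (pairs D).
Proof.
move=> [X [f [_ _ fi _]]] [Y [g [_ _ gi _]]].
apply: (induced_cozero_opens (induced_comp set_val_induced (induced_prod fi gi))).
exact: pseudometric_cozero_opens.
Qed.

Lemma pairs_hausdorff : borel_space R S -> borel_space R A ->
  hausdorff_space (pairs D).
Proof.
move=> /borel_space_hausdorff hS /borel_space_hausdorff hA k l kl.
apply: val_inj; rewrite [LHS]surjective_pairing [RHS]surjective_pairing.
congr (_, _).
  apply: hS => U V kU lV.
  have [x [Ux Vx]] := kl _ _ (continuous_state kU) (continuous_state lV).
  by exists (state x).
apply: hA => U V kU lV.
have [x [Ux Vx]] := kl _ _ (continuous_action kU) (continuous_action lV).
by exists (action x).
Qed.

End topology_of_pairs.

(** * Integrability under a feasible measure and the weak duality inequality *)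

Section weak_duality.
Context {R : realType} {S A : ptopologicalType} {D : action_map S A}.
Variables (Q : R.-pker (borel (pairs D)) ~> (borel S)) (r z : pairs D -> R).
Hypotheses (r_meas : measurable_fun [set: borel (pairs D)] r)
  (z_meas : measurable_fun [set: borel (pairs D)] z)
  (r_le0 : forall k, r k <= 0)
  (z_bounded : exists M : R, forall k, `|z k| <= M)
  (Q_integrable : forall k : pairs D,
     (Q k).-integrable [set: borel S] (EFin \o state_weight r)).

Let Qint (h : S -> R) (k : pairs D) := \int[Q k]_x h x.

Lemma state_weight_le k : state_weight r (state k) <= weight r k.
Proof.
rewrite /state_weight /weight lerD2l lerN2; apply: ub_le_sup; last by exists k.
by exists 0 => _ [l _ <-].
Qed.

Lemma state_weight_ge1 s : 1 <= state_weight r s.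
Proof.
rewrite /state_weight lerDl oppr_ge0; apply: ge_sup => [|_ [k _ <-]//].
have [a Da] := actions_neq0 D s.
pose k : pairs D := exist _ (s, a) (mem_set Da : (s, a) \in graph D).
by exists (r k), k.
Qed.

Lemma F_stateP h : F_ (state_weight r) h ->
  exists2 C, 0 <= C & forall s, `|h s| <= C * state_weight r s.
Proof.
move=> [_ [C hC]]; exists `|C| => // s.
have w0 : 0 < state_weight r s by exact: lt_le_trans (state_weight_ge1 s).
rewrite -ler_pdivrMr//; apply: le_trans (ler_norm C).
by apply: hC; exists s.
Qed.

Lemma F_state_Q_integrable h : F_ (state_weight r) h ->
  forall k, (Q k).-integrable [set: borel S] (EFin \o h).
Proof.
move=> Fh k; have [C C0 hC] := F_stateP Fh; have [mh _] := Fh.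
apply: (le_integrable measurableT _ _ (integrableZl measurableT C (Q_integrable k))).
  exact/measurable_EFinP.
move=> s _; rewrite /= lee_fin; apply: le_trans (hC s) _.
exact: ler_norm.
Qed.

Section feasible.
Context d (Omega : measurableType d) (PY : probability Omega R).
Variables (Y : {RV PY >-> R}) (a b : R).
Hypothesis Y_support : PY [set omega | a <= Y omega <= b] = 1%E.
Variable mu : {finite_measure set (borel (pairs D)) -> \bar R}.
Hypothesis mu_feasible : primal_feasible Q r z a b (benchmark Y) mu.

Lemma feasible_weight_integrable :
  mu.-integrable setT (EFin \o (weight r)).
Proof.
have [w_lt _ _ _] := mu_feasible.
apply/integrableP; split.
  apply/measurable_EFinP; apply: measurable_funB => //; exact: measurable_cst.
under eq_integral do rewrite /= ger0_norm ?subr_ge0 ?(le_trans (r_le0 _))//.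
exact: w_lt.
Qed.

Lemma feasible_reward_integrable : mu.-integrable setT (EFin \o r).
Proof.
apply: le_integrable feasible_weight_integrable => //; first exact/measurable_EFinP.
move=> k _; rewrite lee_fin /weight ler0_norm//.
by apply: le_trans (ler_norm _); have := r_le0 k; lra.
Qed.

Lemma feasible_mass : mu setT = 1%E.
Proof. by have [_ _ <- _] := mu_feasible; rewrite integral_cst// mul1e. Qed.

(** The constraint [L0 Q mu B = 0] in the form of a mixture. Finiteness of the marginal permits
    reading the vanishing extended difference as an equality. *)
Lemma feasible_marginal (B : set (borel S)) : measurable B ->
  marginal mu B = (\int[mu]_k Q k B)%E.
Proof.
move=> mB; have [_ /(_ B mB) + _ _] := mu_feasible; rewrite /L0.
have : marginal mu B \is a fin_num.
  rewrite /marginal /pushforward fin_num_measure// -[X in measurable X]setTI.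
  exact: measurable_state.
by case: (marginal mu B) => // x _; case: (\int[mu]_k Q k B)%E => // y /eqP;
  rewrite -EFinB eqe subr_eq0 => /eqP ->.
Qed.

(** [h] composed with [state] is dominated by a multiple of [weight r], which [mu] integrates.
    Invariance of the marginal equates the two integrals, so the terms in [h] cancel in the dual
    constraint. *)
Lemma feasible_state_integrable h : F_ (state_weight r) h ->
  [/\ mu.-integrable setT (EFin \o (h \o state)),
      mu.-integrable setT (EFin \o (Qint h))
    & \int[mu]_k h (state k) = \int[mu]_k Qint h k].
Proof.
move=> Fh; have [C C0 hC] := F_stateP Fh; have [mh _] := Fh.
have mhs : measurable_fun [set: borel (pairs D)] (h \o state).
  exact: measurableT_comp mh measurable_state.
have ihs : mu.-integrable setT (EFin \o (h \o state)).
  apply: (le_integrable measurableT _ _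
    (integrableZl measurableT C feasible_weight_integrable)).
    exact/measurable_EFinP.
  move=> k _; rewrite /= lee_fin; apply: le_trans (hC _) _.
  by apply: le_trans (ler_norm _); rewrite ler_wpM2l// state_weight_le.
have mEh : measurable_fun [set: borel S] (EFin \o h) by exact/measurable_EFinP.
have im : (marginal mu).-integrable setT (EFin \o h).
  exact: (integrable_pushforward measurable_state mEh ihs measurableT).
have [iQ QE] := Rintegral_mixture feasible_marginal im (F_state_Q_integrable Fh).
split=> //; rewrite -QE /Rintegral; congr fine.
exact/esym/(integral_pushforward measurable_state mEh ihs measurableT).
Qed.

Lemma utility_benchmark_integrable u : utility a b u ->
  PY.-integrable setT (EFin \o (u \o Y)).
Proof.
move=> uu; apply: (utility_comp_integrable (M := `|a| + `|b|) uu) => //.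
have mAB : measurable [set omega | a <= Y omega <= b].
  rewrite (_ : mkset _ = Y @^-1` `[a, b]); last first.
    by apply/seteqP; split=> x; rewrite /= in_itv.
  by rewrite -[X in measurable X]setTI; exact: measurable_funP.
exists (~` [set omega | a <= Y omega <= b]); split.
- exact: measurableC.
- by have := probability_setC PY mAB; rewrite Y_support subee.
- apply: subsetC => omega /= /andP[ae eb].
  by rewrite ler_norml; have := ler_norm b; have := ler_norm (- a);
    have := normr_ge0 a; have := normr_ge0 b; rewrite normrN; lra.
Qed.

Lemma feasible_utility_integrable u : utility a b u ->
  mu.-integrable setT (EFin \o (u \o z)).
Proof.
move=> uu; have [M zM] := z_bounded.
by apply: (utility_comp_integrable (M := M) uu) => //; exact: aeW.
Qed.

(** The dominance constraint is integrated over eta against [L], and Tonelli's theorem exchanges the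
    integrals; passing to shortfalls reverses the inequality. *)
Lemma feasible_utility_ge u : utility a b u ->
  \int[PY]_omega u (Y omega) <= \int[mu]_k u (z k).
Proof.
move=> uu; have [L uE] := uu.
have RE d' (T : measurableType d') (nu : {finite_measure set T -> \bar R})
    (f : T -> R) : nu.-integrable setT (EFin \o (u \o f)) ->
    (- (\int[nu]_t u (f t)))%:E = (\int[nu]_t (- u (f t))%:E)%E.
  move=> iuf; under eq_integral do rewrite EFinN.
  rewrite integralN; last exact: integrable_add_def.
  by rewrite EFinN /Rintegral fineK//; exact: integrable_fin_num iuf.
rewrite -lerN2 -lee_fin RE; last exact: feasible_utility_integrable.
rewrite RE; last exact: utility_benchmark_integrable.
rewrite (utility_fubini _ uE z_meas) (utility_fubini _ uE)//.
have lossE d' (T : measurableType d') (nu : {measure set T -> \bar R})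
    (f : T -> R) eta :
    (\int[nu]_t (neg_part (f t - eta))%:E =
     - \int[nu]_t (shortfall (f t - eta))%:E)%E.
  rewrite -integral_ge0N; last by move=> t _; rewrite lee_fin shortfall_ge0.
  by apply: eq_integral => t _; rewrite /shortfall EFinN oppeK.
have [_ _ _ L1y] := mu_feasible.
apply: ge0_le_integral => //.
- by move=> eta _; apply: integral_ge0 => k _; rewrite lee_fin shortfall_ge0.
- by apply: measurable_funTS; exact: measurable_integral_shortfall.
- by apply: measurable_funTS; exact: measurable_integral_shortfall.
- move=> eta /=; rewrite in_itv/= => /L1y.
  by rewrite /benchmark unlock /L1 !lossE leeN2.
Qed.

(** The case [t = 1] is the usual inequality; [t = 0] handles certificates without reward, for which
    one cannot divide by [t]. *)
Theorem weak_duality h beta u t : 0 <= t -> F_ (state_weight r) h ->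
  utility a b u ->
  (forall k, t * r k + u (z k) <= beta + (h (state k) - Qint h k)) ->
  t * (\int[mu]_k r k) + \int[mu]_k u (z k) <= beta.
Proof.
move=> t0 Fh uu le; have [ihs iQ hQE] := feasible_state_integrable Fh.
have ir := feasible_reward_integrable; have iu := feasible_utility_integrable uu.
have itr : mu.-integrable setT (EFin \o (fun k => t * r k)).
  exact: (integrableZl measurableT t ir).
have ihQ : mu.-integrable setT (EFin \o (fun k => h (state k) - Qint h k)).
  exact: (integrableB measurableT ihs iQ).
have ib : mu.-integrable setT (EFin \o (fun=> beta)).
  exact: finite_measure_integrable_cst.
have : \int[mu]_k (t * r k + u (z k)) <=
       \int[mu]_k (beta + (h (state k) - Qint h k)).
  apply: le_Rintegral => //; first exact: (integrableD measurableT itr iu).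
  exact: (integrableD measurableT ib ihQ).
rewrite (RintegralD measurableT itr iu) (RintegralZl t measurableT ir).
rewrite (RintegralD measurableT ib ihQ) (RintegralB measurableT ihs iQ).
rewrite hQE subrr addr0.
by rewrite Rintegral_cst// [X in fine X]feasible_mass mulr1.
Qed.

End feasible.
End weak_duality.

(** * Absence of a duality gap *)

Section kernel_bind.
Context d1 d2 (X : measurableType d1) (Y : measurableType d2) (R : realType).
Variables (mu : {finite_measure set X -> \bar R}) (Q : R.-pker X ~> Y).
Local Open Scope ereal_scope.

(** The law of the next state when the current pair is distributed according to [mu]. *)
Definition kernel_bind (B : set Y) : \bar R := \int[mu]_x Q x B.

Let kernel_bind0 : kernel_bind set0 = 0.
Proof. by apply: integral0_eq => x _; rewrite measure0. Qed.

Let kernel_bind_ge0 B : 0 <= kernel_bind B.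
Proof. by apply: integral_ge0. Qed.

Let kernel_bind_sigma_additive : semi_sigma_additive kernel_bind.
Proof.
move=> F mF tF mUF; rewrite [X in _ --> X](_ : _ = \sum_(i <oo) kernel_bind (F i)).
  by apply: is_cvg_nneseries => // n _ _; exact: kernel_bind_ge0.
rewrite /kernel_bind -integral_nneseries//; last first.
  by move=> n; exact: measurable_kernel.
by apply: eq_integral => x _; rewrite measure_semi_bigcup.
Qed.

HB.instance Definition _ := isMeasure.Build _ _ _ kernel_bind
  kernel_bind0 kernel_bind_ge0 kernel_bind_sigma_additive.

Let kernel_bind_fin : fin_num_fun kernel_bind.
Proof.
move=> B mB; rewrite ge0_fin_numE ?kernel_bind_ge0//.
apply: (@le_lt_trans _ _ (\int[mu]_x 1)).
  apply: ge0_le_integral => //; first exact: measurable_kernel.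
  move=> x _; rewrite -(@prob_kernel _ _ _ _ _ Q x).
  by apply: le_measure; rewrite ?inE.
by rewrite integral_cst// mul1e -ge0_fin_numE// fin_num_measure.
Qed.

HB.instance Definition _ := Measure_isFinite.Build _ _ _ kernel_bind
  kernel_bind_fin.

End kernel_bind.

Section marginal_finite.
Context {R : realType} {S A : ptopologicalType} {D : action_map S A}.
Variable mu : {finite_measure set (borel (pairs D)) -> \bar R}.

Let marginal_fin : fin_num_fun (marginal mu).
Proof.
move=> B mB; rewrite /marginal /pushforward fin_num_measure//.
by rewrite -[X in measurable X]setTI; exact: measurable_state.
Qed.

HB.instance Definition _ := Measure_isFinite.Build _ _ _ (marginal mu)
  marginal_fin.

End marginal_finite.

(** * Construction of a feasible measure that reaches the dual value *)

Section strong_duality.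
Context {R : realType} {S A : ptopologicalType}.
Hypotheses (S_borel : borel_space R S) (A_borel : borel_space R A).
Variable D : action_map S A.
Local Notation K := (pairs D).
Variables (Q : R.-pker (borel K) ~> (borel S)) (r z : K -> R).
Hypotheses (r_meas : measurable_fun [set: borel K] r)
  (z_meas : measurable_fun [set: borel K] z).
Context d (Omega : measurableType d) (PY : probability Omega R).
Variables (Y : {RV PY >-> R}) (a b : R).
Hypotheses (Y_support : PY [set omega | a <= Y omega <= b] = 1%E)
  (r_le0 : forall k, r k <= 0)
  (r_compact : forall eps : R, 0 <= eps -> compact [set k : K | - eps <= r k])
  (z_bounded : exists M : R, forall k, `|z k| <= M)
  (z_usc : upper_semicontinuous z)
  (Q_weak : weakly_continuous Q)
  (Q_integrable : forall k : K,
     (Q k).-integrable [set: borel S] (EFin \o state_weight r)).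
Variable mu : {finite_measure set (borel K) -> \bar R}.
Hypothesis mu_feasible : primal_feasible Q r z a b (benchmark Y) mu.
Variables (h : S -> R) (beta : R) (u : R -> R).
Hypothesis dual_opt : dual_optimal Q r z a b Y h beta u.

Let Qint (h : S -> R) (k : K) := \int[Q k]_x h x.
Let EY (u : R -> R) := \int[PY]_omega u (Y omega).
Let v := beta - EY u.

Let expectationE u' : utility a b u' -> ('E_PY[u' \o Y])%E = (EY u')%:E.
Proof.
move=> uu; rewrite unlock /EY /Rintegral fineK//.
exact: integrable_fin_num (utility_benchmark_integrable Y_support uu).
Qed.

Let dual_valueE b' u' : utility a b u' -> dual_value Y b' u' = (b' - EY u')%:E.
Proof. by move=> uu; rewrite /dual_value expectationE. Qed.

Let EYD u1 u2 : utility a b u1 -> utility a b u2 ->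
  EY (fun x => u1 x + u2 x) = EY u1 + EY u2.
Proof.
move=> U1 U2; have I1 := utility_benchmark_integrable Y_support U1.
have I2 := utility_benchmark_integrable Y_support U2.
exact: (RintegralD measurableT I1 I2).
Qed.

Let EYZ c u1 : utility a b u1 -> EY (fun x => c * u1 x) = c * EY u1.
Proof.
move=> U1; have I1 := utility_benchmark_integrable Y_support U1.
exact: (RintegralZl c measurableT I1).
Qed.

Let state_fct_integrable h' : continuous h' -> bounded_fct h' ->
  forall k, (Q k).-integrable [set: borel S] (EFin \o h').
Proof.
move=> ch [M hM] k; apply: measurable_bounded_integrable => //.
- by rewrite prob_kernel ltry.
- exact: continuous_borel_measurable.
- exists M; split; first exact: num_real.
  by move=> N MN x _; apply: le_trans (ltW MN).
Qed.

Let QintD h1 h2 k : continuous h1 -> bounded_fct h1 -> continuous h2 ->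
  bounded_fct h2 -> Qint (fun s => h1 s + h2 s) k = Qint h1 k + Qint h2 k.
Proof.
move=> c1 b1 c2 b2; have I1 := state_fct_integrable c1 b1 k.
have I2 := state_fct_integrable c2 b2 k.
exact: (RintegralD measurableT I1 I2).
Qed.

Let QintZ c h1 k : continuous h1 -> bounded_fct h1 ->
  Qint (fun s => c * h1 s) k = c * Qint h1 k.
Proof.
move=> c1 b1; have I1 := state_fct_integrable c1 b1 k.
exact: (RintegralZl c measurableT I1).
Qed.

(** Since [state_weight r] is at least 1, the restricted multipliers belong to the weighted space
    and remain admissible in the dual. *)
Let bounded_continuous_F h' : continuous h' -> bounded_fct h' ->
  F_ (state_weight r) h'.
Proof.
move=> ch [M hM]; split; first exact: continuous_borel_measurable.
exists M => _ [s _ <-]; have w1 := state_weight_ge1 r_le0 s.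
rewrite ler_pdivrMr; last exact: lt_le_trans w1.
by apply: le_trans (hM s) _; rewrite ler_peMr// (le_trans _ (hM s)).
Qed.

(* The reward enters with a coefficient t >= 0 priced at the dual value v, so
   that p := inf {x | certified f x} is finite on bounded f even though r is
   unbounded. *)
Let certified (f : K -> R) (x : R) := exists t h' b' u',
  [/\ 0 <= t, continuous h' /\ bounded_fct h', utility a b u',
      forall k, f k + t * r k + u' (z k) <= b' + (h' (state k) - Qint h' k)
    & x = b' - EY u' - t * v].

Let certified_D f g x y : certified f x -> certified g y ->
  certified (fun k => f k + g k) (x + y).
Proof.
move=> [t1 [h1 [b1 [u1 [t10 [c1 B1] U1 le1 ->]]]]].
move=> [t2 [h2 [b2 [u2 [t20 [c2 B2] U2 le2 ->]]]]].
exists (t1 + t2), (fun s => h1 s + h2 s), (b1 + b2), (fun x => u1 x + u2 x).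
split.
- exact: addr_ge0.
- by split; [move=> s; apply: cvgD; [exact: c1|exact: c2]|exact: bounded_fctD].
- exact: utilityD.
- by move=> k; rewrite QintD//; have := le1 k; have := le2 k; lra.
- by rewrite EYD//; lra.
Qed.

Let certified_Z c f x : 0 <= c -> certified f x ->
  certified (fun k => c * f k) (c * x).
Proof.
move=> c0 [t [h' [b' [u' [t0 [c1 B1] U1 le1 ->]]]]].
exists (c * t), (fun s => c * h' s), (c * b'), (fun x => c * u' x).
split.
- exact: mulr_ge0.
- split; last exact: bounded_fctZ.
  by move=> s; apply: (cvgM (cvg_cst _)); exact: c1.
- exact: utilityZ.
- by move=> k; rewrite QintZ//; have := ler_wpM2l c0 (le1 k); lra.
- by rewrite EYZ//; lra.
Qed.

Let utility0 : utility a b (fun=> 0).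
Proof.
have [[_ uu _] _] := dual_opt; have := utilityZ (lexx 0) uu.
by congr (utility a b _); apply/funext => x; rewrite mul0r.
Qed.

Let EY0 : EY (fun=> 0) = 0.
Proof. by rewrite /EY Rintegral_cst// mul0r. Qed.

Let certified_state f h' b' : continuous h' -> bounded_fct h' ->
  (forall k, f k <= b' + (h' (state k) - Qint h' k)) -> certified f b'.
Proof.
move=> ch bh le; exists 0, h', b', (fun=> 0); split => //.
- by move=> k; rewrite mul0r !addr0; exact: le.
- by rewrite EY0 mul0r !subr0.
Qed.

Let Qint0 k : Qint (fun=> 0) k = 0.
Proof. by rewrite /Qint Rintegral_cst// mul0r. Qed.

Let certified_le f b' : (forall k, f k <= b') -> certified f b'.
Proof.
move=> le; apply: (@certified_state _ (fun=> 0)).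
- by move=> s; exact: cvg_cst.
- exact: bounded_fct_cst.
- by move=> k; rewrite Qint0 subr0 addr0; exact: le.
Qed.

(** The bound on [f] is absorbed into [b']. For t > 0, division by [t] gives a dual feasible triple,
    whose value is at least [v]. For t = 0, weak duality against the feasible measure [mu] takes
    over. *)
Let certified_ge f M x : (forall k, `|f k| <= M) -> certified f x -> - M <= x.
Proof.
move=> fM [t [h' [b' [u' [t0 [c1 B1] U1 le1 ->]]]]].
have le k : t * r k + u' (z k) <= (b' + M) + (h' (state k) - Qint h' k).
  by have := le1 k; have := fM k; rewrite ler_norml; lra.
suff : t * v <= b' + M - EY u' by lra.
move: t0; rewrite le_eqVlt => /predU1P[t0|t0].
  have := weak_duality r_meas z_meas r_le0 z_bounded Q_integrable mu_feasible
    (lexx 0) (bounded_continuous_F c1 B1) U1.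
  move=> /(_ (b' + M)) H.
  have := feasible_utility_ge z_meas z_bounded Y_support mu_feasible U1.
  rewrite -t0 mul0r -/(EY u'); have := H _; rewrite mul0r add0r => {}H.
  have /H : forall k, 0 * r k + u' (z k) <= b' + M + (h' (state k) - \int[Q k]_x h' x).
    by move=> k; rewrite t0; exact: le.
  lra.
have [[_ uu _] opt] := dual_opt.
have c0 : 0 <= t^-1 by rewrite invr_ge0 ltW.
have U2 := utilityZ c0 U1.
have := opt (fun s => t^-1 * h' s) (t^-1 * (b' + M)) (fun x => t^-1 * u' x).
rewrite !dual_valueE// lee_fin EYZ// -/v -mulrBr => H.
rewrite -ler_pdivlMl//; apply: H; split=> //.
  apply: bounded_continuous_F; last exact: bounded_fctZ.
  by move=> s; apply: (cvgM (cvg_cst _)); exact: c1.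
move=> k; have := ler_wpM2l c0 (le k).
rewrite -/(Qint _ k) QintZ// !mulrDr mulrA mulVf ?gt_eqF// mul1r.
lra.
Qed.

Let V := K -> R^o.
Let B : set V := [set f | bounded_fct (f : K -> R)].
Let p (f : V) : R := inf [set x | certified f x].

Let B_subspace : subspace_set B.
Proof.
split=> [|f g Bf Bg|c f Bf]; first exact: bounded_fct_cst.
- exact: bounded_fctD.
- exact: bounded_fctZ.
Qed.

Let p_inf f : B f -> has_inf [set x | certified f x].
Proof.
move=> [M fM]; split.
  by exists M; apply: certified_le => k; apply: le_trans (ler_norm _) (fM k).
by exists (- M) => x; exact: certified_ge.
Qed.

Let p_le f x : B f -> certified f x -> p f <= x.
Proof. by move=> Bf cf; apply: ge_inf => //; case: (p_inf Bf). Qed.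

Let p_sublinear : sublinear B p.
Proof.
have [_ BD BZ] := B_subspace.
split=> [f g Bf Bg|c f].
  rewrite -lerBlDr; apply: lb_le_inf => [|x cx]; first by case: (p_inf Bf).
  rewrite lerBlDr -lerBlDl; apply: lb_le_inf => [|y cy]; first by case: (p_inf Bg).
  by rewrite lerBlDl; apply: p_le; [exact: BD|exact: certified_D].
rewrite le_eqVlt => /predU1P[<-|c0] Bf.
  rewrite scale0r mul0r; apply/eqP; rewrite eq_le; apply/andP; split.
    by apply: p_le; [exact: bounded_fct_cst|exact: certified_le].
  apply: lb_le_inf => [|x cx]; first by case: (p_inf (bounded_fct_cst K 0)).
  by rewrite -oppr0; apply: (certified_ge _ cx) => k; rewrite normr0.
apply/eqP; rewrite eq_le; apply/andP; split.
  rewrite -ler_pdivrMl//; apply: lb_le_inf => [|x cx]; first by case: (p_inf Bf).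
  rewrite ler_pdivrMl//; apply: p_le; first exact: BZ.
  by apply: certified_Z => //; exact: ltW.
apply: lb_le_inf => [|x cx]; first by case: (p_inf (BZ c f Bf)).
rewrite -ler_pdivlMl//; apply: p_le => //.
have : certified (fun k => c^-1 * (c *: f) k) (c^-1 * x).
  by apply: certified_Z => //; rewrite invr_ge0 ltW.
congr (certified _ _); apply/funext => k.
by rewrite [(c *: f) k]/(c * f k) mulrA mulVf ?mul1r// gt_eqF.
Qed.

(** The set {- r > c} is the complement of the compact, hence closed, set {r >= - c} if c >= 0, and
    everything if c < 0. The truncation at [n] provides boundedness. *)
Let lsc_neg_reward n : lower_semicontinuous_fct (fun k => Num.min (- r k) n).
Proof.
move=> c; have [nc|cn] := leP n c.
  rewrite (_ : mkset _ = set0); first exact: open0.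
  rewrite -subset0 => k /=; rewrite lt_min => /andP[_ cn].
  by have := lt_le_trans cn nc; rewrite ltxx.
have [c0|c0] := leP 0 c; last first.
  rewrite (_ : mkset _ = setT); first exact: openT.
  rewrite -subTset => k _ /=; rewrite lt_min cn andbT.
  by rewrite (lt_le_trans c0)// oppr_ge0.
rewrite (_ : mkset _ = ~` [set k | - c <= r k]).
  apply: closed_openC; apply: compact_closed.
    exact: pairs_hausdorff S_borel A_borel.
  exact: r_compact.
apply/seteqP; split=> k /=; rewrite lt_min cn andbT ltrNr.
  by rewrite ltNge => /negP.
by move=> /negP; rewrite -ltNge.
Qed.

(** [shortfall] is nonincreasing, so upper semicontinuity of [z] turns into lower semicontinuity. *)
Let lsc_shortfall eta : lower_semicontinuous_fct (fun k => shortfall (z k - eta)).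
Proof.
move=> c; have [c0|c0] := leP 0 c; last first.
  rewrite (_ : mkset _ = setT); first exact: openT.
  by rewrite -subTset => k _ /=; rewrite (lt_le_trans c0)// shortfall_ge0.
rewrite (_ : mkset _ = [set k | z k < eta - c]).
  rewrite openE => k /= zk; have [W kW Wz] := z_usc zk.
  by apply: filterS kW.
apply/seteqP; split=> k /=;
  by rewrite /shortfall /neg_part /Num.min; case: (ltP (z k - eta) 0) => ? ?; lra.
Qed.

Let shortfall_bounded eta : bounded_fct (fun k => shortfall (z k - eta)).
Proof.
have [M zM] := z_bounded; exists (M + `|eta|) => k.
rewrite ger0_norm ?shortfall_ge0//; apply: le_trans (shortfall_le_norm _) _.
by apply: le_trans (ler_normB _ _) _; rewrite lerD2r.
Qed.

Let neg_reward_bounded n : 0 <= n -> bounded_fct (fun k => Num.min (- r k) n).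
Proof.
move=> n0; exists n => k; rewrite ger0_norm ?ge_min ?lexx ?orbT//.
by rewrite le_min n0 oppr_ge0 r_le0.
Qed.

(** Positivity and normalization come from domination alone: E(f - g) <= 0 whenever f <= g, while
    E(1) <= 1 and E(-1) <= -1. *)
Let dual_mean : exists2 E : (K -> R) -> R, mean_on (@bounded_fct R K) E
  & forall f x, bounded_fct f -> certified f x -> E f <= x.
Proof.
have [l [lD lZ lp]] := hahn_banach_dominated B_subspace p_sublinear.
have lle f x : bounded_fct f -> certified f x -> l f <= x.
  by move=> Bf cf; apply: le_trans (lp _ Bf) (p_le Bf cf).
have B1 (c : R) : bounded_fct (fun _ : K => c) := bounded_fct_cst K c.
exists l => //; split.
- by move=> f g Bf Bg; exact: lD.
- by move=> c f Bf; exact: lZ.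
- move=> f g Bf Bg fg.
  have BN : bounded_fct (fun k => -1 * g k) by exact: bounded_fctZ.
  have Ng : l (fun k => -1 * g k) = -1 * l g by exact: lZ.
  have : l (fun k => f k + -1 * g k) <= 0.
    apply: lle; first exact: bounded_fctD.
    by apply: certified_le => k; have := fg k; lra.
  by rewrite [X in X <= 0](lD f (fun k => -1 * g k))// Ng; lra.
- apply/eqP; rewrite eq_le; apply/andP; split.
    by apply: lle => //; apply: certified_le => k; exact: lexx.
  have Z (c : R) (f : K -> R) : bounded_fct f ->
      l (fun k => c * f k) = c * l f by exact: lZ.
  have := Z (-1) _ (B1 1).
  have : l (fun=> -1 * 1) <= -1 by apply: lle => //; apply: certified_le => k; lra.
  lra.
Qed.

(** With [t = 1] the reward offsets the truncated loss at a price that does not depend on [n]. This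
    drives both tightness and the lower bound on the mean reward. *)
Let certified_neg_reward n : certified (fun k => Num.min (- r k) n) (- v).
Proof.
exists 1, (fun=> 0), 0, (fun=> 0); split=> //.
- by split; [move=> s; exact: cvg_cst|exact: bounded_fct_cst].
- move=> k; rewrite Qint0 subrr mul1r !addr0.
  by rewrite /Num.min; case: ltP => ?; lra.
- by rewrite EY0; lra.
Qed.

(** The utility with kink at eta offsets the shortfall; its price is the benchmark side of the
    dominance constraint. *)
Let certified_shortfall eta : a <= eta <= b ->
  certified (fun k => shortfall (z k - eta)) (- EY (fun y => neg_part (y - eta))).
Proof.
move=> ab; exists 0, (fun=> 0), 0, (fun x => neg_part (x - eta)); split=> //.
- by split; [move=> s; exact: cvg_cst|exact: bounded_fct_cst].
- exact: utility_neg_part.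
- by move=> k; rewrite Qint0 subrr addr0 mul0r addr0 /shortfall; lra.
- by rewrite mul0r; lra.
Qed.

Let dual_measure : exists P : probability (borel K) R,
  forall f x, bounded_fct f -> lower_semicontinuous_fct f -> certified f x ->
    \int[P]_k f k <= x.
Proof.
have [E [ED EZ EM E1] Ele] := dual_mean.
have [||||P PE] := @tight_mean_representation R K E.
- exact: pairs_cozero_opens S_borel A_borel.
- exact: pairs_hausdorff S_borel A_borel.
- by split.
(* Markov's inequality: [g] equals [n] off [C], so 1 <= g / n + 1_C, while E(g) <= - v. The choice
   of [n] makes |v| / n at most [e], and the summand 1 keeps [n] positive. *)
- move=> e e0; pose n := `|v| / e + 1.
  have n0 : 0 < n by rewrite /n ltr_wpDl// divr_ge0// ltW.
  exists [set k | - n <= r k]; first exact/r_compact/ltW.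
  set C := [set k | _]; pose g k := Num.min (- r k) n.
  have Bg : bounded_fct g by exact/neg_reward_bounded/ltW.
  have Eg : E g <= - v by apply: Ele => //; exact: certified_neg_reward.
  have BC : bounded_fct (\1_C : K -> R) by exact: bounded_fct_indic.
  have Bg' : bounded_fct (fun k => n^-1 * g k) by exact: bounded_fctZ.
  have : E (fun=> 1) <= E (fun k => n^-1 * g k + \1_C k).
    apply: EM; [exact: bounded_fct_cst|exact: bounded_fctD|move=> k].
    rewrite indicE; have [kC|/negP kC] := boolP (k \in C).
      by rewrite lerDr mulr_ge0 ?invr_ge0 ?(ltW n0)// le_min oppr_ge0 r_le0/= ltW.
    have rn : r k < - n by rewrite ltNge; apply/negP => nr; apply: kC; exact/mem_set.
    by rewrite addr0 /g min_r ?mulVf ?gt_eqF//; lra.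
  rewrite E1 ED// EZ// => le1; suff : n^-1 * E g <= e by lra.
  rewrite ler_pdivrMl//; apply: le_trans Eg _; apply: le_trans (ler_norm _) _.
  by rewrite normrN /n mulrDl divfK ?gt_eqF// mul1r lerDl ltW.
exists P => f x Bf lf cf; apply: le_trans (PE _ Bf lf) (Ele _ _ Bf cf).
Qed.

Let Pintegrable (P : probability (borel K) R) f : bounded_fct f ->
  lower_semicontinuous_fct f -> P.-integrable setT (EFin \o f).
Proof.
move=> bf lf; apply: bounded_fct_integrable => //.
exact: lsc_borel_measurable.
Qed.

Let PintegralE (P : probability (borel K) R) f : bounded_fct f ->
  lower_semicontinuous_fct f -> (\int[P]_k (f k)%:E)%E = (\int[P]_k f k)%:E.
Proof.
move=> bf lf; rewrite /Rintegral fineK//.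
by have /integrable_fin_num -> := Pintegrable P bf lf.
Qed.

(** The truncations of - r increase to it under one common bound, so monotone convergence
    applies. *)
Let neg_reward_integral (P : probability (borel K) R) :
  (forall f x, bounded_fct f -> lower_semicontinuous_fct f -> certified f x ->
    \int[P]_k f k <= x) ->
  (\int[P]_k (- r k)%:E <= (- v)%:E)%E.
Proof.
move=> Ple; pose g n k := Num.min (- r k) n%:R.
have bg n : bounded_fct (g n) by apply: neg_reward_bounded.
have lg n : lower_semicontinuous_fct (g n) by exact: lsc_neg_reward.
have mg n : measurable_fun [set: borel K] (EFin \o g n).
  by apply/measurable_EFinP; exact: lsc_borel_measurable.
have -> : (\int[P]_k (- r k)%:E = \int[P]_k limn (fun n => (g n k)%:E : \bar R))%E.
  apply: eq_integral => k _; apply/esym/cvg_lim => //.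
  apply: cvg_near_cst; near=> n; rewrite /g min_l//.
  by near: n; exact: nbhs_infty_ger.
rewrite monotone_convergence//; last 2 first.
- by move=> n k _; rewrite lee_fin le_min ler0n oppr_ge0 r_le0.
- move=> k _ i j ij; rewrite lee_fin le_min !ge_min lexx/=.
  by rewrite ler_nat ij orbT.
apply: lime_le.
  apply: ereal_nondecreasing_is_cvgn => i j ij; apply: ge0_le_integral => //.
  - by move=> k _; rewrite lee_fin le_min ler0n oppr_ge0 r_le0.
  - exact: mg.
  - exact: mg.
  - move=> k _; rewrite lee_fin le_min !ge_min lexx/=.
    by rewrite ler_nat ij orbT.
near=> n; rewrite PintegralE// lee_fin; apply: Ple => //.
exact: certified_neg_reward.
Unshelve. all: by end_near. Qed.

(** Each constraint of the primal problem is read off from a certificate: multipliers give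
    invariance, utilities give dominance, and the reward term gives integrability and the value. *)
Theorem strong_duality_exists :
  exists2 P : {finite_measure set (borel K) -> \bar R},
    primal_feasible Q r z a b (benchmark Y) P & v <= \int[P]_k r k.
Proof.
have [P Ple] := dual_measure.
have ler := neg_reward_integral Ple.
have mNr : measurable_fun [set: borel K] (fun k => (- r k)%:E).
  by apply/measurable_EFinP; apply: measurableT_comp.
have Nr_ge0 : (0 <= \int[P]_k (- r k)%:E)%E.
  by apply: integral_ge0 => k _; rewrite lee_fin oppr_ge0.
have P1 : (\int[P]_k 1 = 1)%E.
  by rewrite integral_cst// mul1e; exact: probability_setT.
have Qinv h' : continuous h' -> bounded_fct h' ->
    \int[marginal P]_s h' s = \int[kernel_bind P Q]_s h' s.
  move=> ch bh.
  have mh : measurable_fun [set: borel S] h' by exact: continuous_borel_measurable.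
  have ikb : (kernel_bind P Q).-integrable setT (EFin \o h').
    exact: bounded_fct_integrable.
  have [_ ->] := @Rintegral_mixture _ _ _ _ _ P Q (kernel_bind P Q)
    (fun _ _ => erefl) h' ikb (state_fct_integrable ch bh).
  have [cQ bQ] := Q_weak ch bh.
  have cs : continuous (fun k : K => h' (state k)).
    move=> k; apply: (@continuous_comp _ _ _ state h'); last exact: ch.
    exact: continuous_state.
  have bs : bounded_fct (fun k : K => h' (state k)).
    by have [M hM] := bh; exists M => k; exact: hM.
  have -> : \int[marginal P]_s h' s = \int[P]_k h' (state k).
    have mEh : measurable_fun [set: borel S] (EFin \o h') by exact/measurable_EFinP.
    rewrite /Rintegral; congr fine.
    apply: (integral_pushforward measurable_state mEh _ measurableT).
    by apply: (@Pintegrable P (fun k => h' (state k))) => //; exact: continuous_lsc.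
  have is_ := @Pintegrable P _ bs (continuous_lsc cs).
  have iQ := @Pintegrable P _ bQ (continuous_lsc cQ).
  have cD1 : continuous (fun k : K => h' (state k) - Qint h' k).
    by move=> k; exact: (cvgB (cs k) (cQ k)).
  have cD2 : continuous (fun k : K => Qint h' k - h' (state k)).
    by move=> k; exact: (cvgB (cQ k) (cs k)).
  have [M1 bs1] := bs; have [M2 bQ2] := bQ.
  (* The constant 0 is certified for the difference by [h'] and for its negative by - h'. Weak
     continuity of [Q] makes both functions continuous, hence lower semicontinuous. *)
  apply/eqP; rewrite eq_le -subr_le0 -(RintegralB measurableT is_ iQ).
  rewrite -[X in _ && X]subr_le0 -(RintegralB measurableT iQ is_).
  apply/andP; split; apply: Ple.
  - exists (M1 + M2) => k; apply: le_trans (ler_normB _ _) _; apply: lerD.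
      exact: bs1.
    exact: bQ2.
  - exact: continuous_lsc.
  - by apply: (@certified_state _ h') => // k; rewrite add0r.
  - exists (M2 + M1) => k; apply: le_trans (ler_normB _ _) _; apply: lerD.
      exact: bQ2.
    exact: bs1.
  - exact: continuous_lsc.
  - apply: (@certified_state _ (fun s => -1 * h' s)).
    + by move=> s; apply: (cvgM (cvg_cst _)); exact: ch.
    + exact: bounded_fctZ.
    + by move=> k; rewrite QintZ// add0r -[X in X - _]/(Qint h' k); lra.
(* Bounded continuous test functions determine the measure, so invariance extends to all Borel
   sets. *)
have QE := cozero_measure_unique (borel_space_cozero_opens S_borel) Qinv.
have FP : primal_feasible Q r z a b (benchmark Y) P.
  split.
  (* As [weight r] is 1 - r, its integral is at most 1 - v. *)
  + have -> : (\int[P]_k (weight r k)%:E = \int[P]_k (1 + (- r k)%:E))%E.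
      by apply: eq_integral => k _; rewrite /weight EFinB.
    rewrite ge0_integralD//; last by move=> k _; rewrite lee_fin oppr_ge0.
    rewrite P1; apply: le_lt_trans (leeD2l _ ler) _.
    by rewrite -EFinD ltry.
  + move=> C mC; rewrite /L0 (QE _ mC) /kernel_bind subee//.
    exact: (fin_num_measure (kernel_bind P Q)).
  + exact: P1.
  + move=> eta ab; have := Ple _ _ (shortfall_bounded eta) (lsc_shortfall eta)
      (certified_shortfall ab).
    have -> : benchmark Y eta = (EY (fun y => neg_part (y - eta)))%:E.
      by rewrite -expectationE//; exact: utility_neg_part.
    rewrite -lee_fin -(PintegralE P (shortfall_bounded eta) (lsc_shortfall eta)).
    rewrite EFinN leeNr => /le_trans; apply.
    rewrite -integral_ge0N; last by move=> k _; rewrite lee_fin shortfall_ge0.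
    rewrite /L1; under eq_integral do rewrite /shortfall EFinN oppeK.
    exact: lexx.
exists P => //; have ir := feasible_reward_integrable r_meas r_le0 FP.
move: ler; under eq_integral do rewrite EFinN.
rewrite integralN; last exact: integrable_add_def ir.
by rewrite EFinN leeN2 /Rintegral -lee_fin fineK//; exact: integrable_fin_num ir.
Qed.

End strong_duality.

(** * Complementary slackness *)

(* A set of full measure contains a countable union of compact sets of full
   measure, whose projection is Borel without any measurable selection. *)
Lemma ae_marginal_of_ae (R : realType) (S A : ptopologicalType)
    (D : action_map S A) (C : (set (pairs D))^nat)
    (mu : {finite_measure set (borel (pairs D)) -> \bar R}) (P : pairs D -> Prop) :
  @cozero_opens R (pairs D) -> hausdorff_space S ->
  (forall n, compact (C n)) -> \bigcup_n C n = setT ->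
  {ae mu, forall k, P k} ->
  {ae marginal mu, forall s, exists2 k, P k & state k = s}.
Proof.
move=> cK hS cC CT [N [mN N0 PN]]; pose G : set (borel (pairs D)) := ~` N.
have mG : measurable G by exact: measurableC.
have [F FP] : {F : (set (pairs D))^nat & forall n, [/\ closed (F n), F n `<=` G
    & (mu (G `\` F n) <= (n.+1%:R^-1)%:E)%E]}.
  apply: (@choice _ _ (fun n F => [/\ closed F, F `<=` G
    & (mu (G `\` F) <= (n.+1%:R^-1)%:E)%E])) => n.
  have n0 : 0 < n.+1%:R^-1 :> R by rewrite invr_gt0 ltr0n.
  by have [F cF [FG mF]] := closed_inner_regular cK mu mG n0; exists F.
pose E := \bigcup_n \bigcup_m (@state S A D @` (F n `&` C m)).
have mE : measurable (E : set (borel S)).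
  apply: bigcup_measurable => n _; apply: bigcup_measurable => m _.
  rewrite -[X in measurable X]setCK; apply: measurableC.
  apply: open_borel_measurable; apply: closed_openC; apply: compact_closed => //.
  apply: continuous_compact.
    by apply: continuous_subspaceT; exact: continuous_state.
  by rewrite setIC; apply: compact_closedI => //; case: (FP n).
exists (~` E); split; first exact: measurableC.
- have mEs : measurable (state @^-1` (~` E) : set (borel (pairs D))).
    by rewrite -[X in measurable X]setTI; apply: measurable_state => //;
      exact: measurableC.
  rewrite /= /marginal /pushforward.
  apply/eqP; rewrite eq_le measure_ge0 andbT; apply/lee_addgt0Pr => e e0.
  rewrite add0e.
  pose n := Num.trunc e^-1.
  have ne : n.+1%:R^-1 <= e.
    by rewrite invf_ple ?posrE ?ltr0n// ltW// truncnS_gt.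
  have [cF FG mF] := FP n.
  have mFn : measurable (F n : set (borel (pairs D))).
    rewrite -[X in measurable X]setCK; apply: measurableC.
    by apply: open_borel_measurable; exact: closed_openC.
  have mGF : measurable (G `\` F n) by exact: measurableD.
  (* A pair whose state lies outside [E] cannot be in [F n]: some [C m] contains it, and its state
     would lie in the projection. *)
  apply: (@le_trans _ _ (mu (N `|` (G `\` F n)))).
    apply: le_measure; rewrite ?inE//; first exact: measurableU.
    move=> k /= nEk; have [Nk|Gk] := pselect (N k); [by left|right; split=> //].
    move=> Fk; apply: nEk; have [m _ Cmk] : (\bigcup_n C n) k by rewrite CT.
    by exists n => //; exists m => //; exists k.
  apply: le_trans (measureU2 _ mN mGF) _.
  by rewrite [X in (X + _)%E]N0 add0e; apply: le_trans mF _; rewrite lee_fin.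
- apply: subsetC => s [n _ [m _ [k [Fk _] <-]]]; exists k => //.
  have [_ FG _] := FP n; apply: contrapT => nPk.
  exact: (FG _ Fk (PN _ nPk)).
Qed.

Theorem theorem4p7 (R : realType) (S A : ptopologicalType)
  (S_borel : borel_space R S) (A_borel : borel_space R A)
  (D : action_map S A) (K_closed : closed (graph D))
  (Q : R.-pker (borel (pairs D)) ~> (borel S))
  (r z : pairs D -> R)
  (r_meas : measurable_fun [set: borel (pairs D)] r)
  (z_meas : measurable_fun [set: borel (pairs D)] z)
  (d : measure_display) (Omega : measurableType d) (PY : probability Omega R)
  (Y : {RV PY >-> R}) (a b : R)
  (Y_support : PY [set omega | a <= Y omega <= b] = 1%E)
  (Delta_neq0 : exists (pi : policy R D) (nu : probability (borel S) R),
     Delta Q r z a b (benchmark Y) pi nu)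
  (r_le0 : forall k, r k <= 0)
  (r_compact : forall eps : R, 0 <= eps ->
     compact [set k : pairs D | - eps <= r k])
  (z_bounded : exists M : R, forall k, `|z k| <= M)
  (z_usc : upper_semicontinuous z)
  (Q_weak : weakly_continuous Q)
  (z_Fw : forall eta, a <= eta <= b ->
     F_ (weight r) (fun k => neg_part (z k - eta)))
  (Q_integrable : forall k : pairs D,
     (Q k).-integrable [set: borel S] (EFin \o state_weight r))
  (Q_Fw : F_ (weight r) (fun k : pairs D => \int[Q k]_x state_weight r x))
  (mu : {finite_measure set (borel (pairs D)) -> \bar R})
  (phi : R.-pker (borel S) ~> (borel A))
  (mu_phi : disintegration mu phi)
  (mu_opt : primal_optimal Q r z a b (benchmark Y) mu)
  (h : S -> R) (beta : R) (u : R -> R)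
  (dual_opt : dual_optimal Q r z a b Y h beta u) :
  (\int[mu]_k (u (z k))%:E = 'E_PY[u \o Y])%E /\
  {ae marginal mu, forall s,
     (beta + h s)%:E =
     ereal_sup [set (r k + u (z k) + \int[Q k]_x h x)%:E
                | k in [set k : pairs D | state k = s]]}.
Proof.
have [mu_feas mu_max] := mu_opt; have [[Fh uu slack_ge0] _] := dual_opt.
have [P P_feas vP] := strong_duality_exists S_borel A_borel r_meas z_meas
  Y_support r_le0 r_compact z_bounded z_usc Q_weak Q_integrable mu_feas dual_opt.
have ir := feasible_reward_integrable r_meas r_le0 mu_feas.
have iu := feasible_utility_integrable z_meas z_bounded mu uu.
have iuY := utility_benchmark_integrable Y_support uu.
have [ihs iQ hQE] := feasible_state_integrable r_meas r_le0 Q_integrable mu_feas Fh.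
(* [P] reaches the dual value, and the optimal [mu] earns at least as much reward as [P]. *)
have no_gap : beta - \int[PY]_omega u (Y omega) <= \int[mu]_k r k.
  apply: le_trans vP _; rewrite -lee_fin /Rintegral.
  rewrite (fineK (integrable_fin_num measurableT ir)).
  rewrite (fineK (integrable_fin_num measurableT
    (feasible_reward_integrable r_meas r_le0 P_feas))).
  exact: mu_max.
have uge := feasible_utility_ge z_meas z_bounded Y_support mu_feas uu.
have le k : 1 * r k + u (z k) <= beta + (h (state k) - \int[Q k]_x h x).
  by rewrite mul1r addrA; exact: slack_ge0.
have := weak_duality r_meas z_meas r_le0 z_bounded Q_integrable mu_feas
  ler01 Fh uu le.
rewrite mul1r => wd.
(* [no_gap], [uge] and [wd] form a closed cycle of inequalities, hence all are equalities. *)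
have uE : \int[mu]_k u (z k) = \int[PY]_omega u (Y omega) by lra.
split.
  rewrite unlock -[LHS](fineK (integrable_fin_num measurableT iu)).
  rewrite -[RHS](fineK (integrable_fin_num measurableT iuY)).
  by congr EFin; exact: uE.
pose slack k := (beta + (h (state k) - \int[Q k]_x h x)) - (r k + u (z k)).
have slack0 k : 0 <= slack k.
  by rewrite subr_ge0; have := le k; rewrite mul1r.
have ib : mu.-integrable setT (EFin \o (fun=> beta)).
  exact: finite_measure_integrable_cst.
have ihQ : mu.-integrable setT (EFin \o (fun k => h (state k) - \int[Q k]_x h x)).
  exact: (integrableB measurableT ihs iQ).
have ibhQ : mu.-integrable setT
    (EFin \o (fun k => beta + (h (state k) - \int[Q k]_x h x))).
  exact: (integrableD measurableT ib ihQ).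
have iru : mu.-integrable setT (EFin \o (fun k => r k + u (z k))).
  exact: (integrableD measurableT ir iu).
have is_ : mu.-integrable setT (EFin \o slack).
  exact: (integrableB measurableT ibhQ iru).
(* By invariance the integral is [beta] minus the mean of r + u(z), and [no_gap] with [uge] bounds
   this above by 0. *)
have slack_int : \int[mu]_k slack k = 0.
  apply/eqP; rewrite eq_le Rintegral_ge0// andbT.
  rewrite (RintegralB measurableT ibhQ iru) (RintegralD measurableT ir iu).
  rewrite (RintegralD measurableT ib ihQ) (RintegralB measurableT ihs iQ).
  rewrite hQE subrr addr0 Rintegral_cst//.
  rewrite [X in fine X](feasible_mass mu_feas) mulr1; lra.
have slack_ae : {ae mu, forall k, slack k = 0}.
  have ms := measurable_int _ is_.
  have abs0 : (\int[mu]_k `|(slack k)%:E| = 0)%E.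
    under eq_integral do rewrite gee0_abs ?lee_fin//.
    rewrite -[LHS](fineK (integrable_fin_num measurableT is_)).
    by congr EFin; exact: slack_int.
  have /(_ abs0) := (ae_eq_integral_abs mu measurableT ms).1.
  by apply: filterS => k /(_ Logic.I) [].
(* The compact level sets of [r] exhaust the pairs, which gives the sigma-compactness that the
   projection argument asks for. *)
have cK : \bigcup_n [set k : pairs D | - n%:R <= r k] = setT.
  rewrite -subTset => k _; exists (Num.trunc (- r k)).+1 => //=.
  by rewrite lerNl ltW// truncnS_gt.
have [N [mN N0 sN]] := ae_marginal_of_ae (pairs_cozero_opens S_borel A_borel)
  (borel_space_hausdorff S_borel) (fun n => r_compact _ (ler0n _ n)) cK slack_ae.
exists N; split=> //; apply: subset_trans sN; apply: subsetC => s [k slk ks].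
(* The pair of zero slack over [s] reaches beta + h(s), and dual feasibility bounds every other pair
   over [s]. *)
apply/eqP; rewrite eq_le; apply/andP; split.
  apply: ereal_sup_ubound; exists k => //; congr EFin.
  by move: slk; rewrite /slack ks; lra.
apply: ge_ereal_sup => _ [l /= ls <-]; rewrite lee_fin.
by have := le l; rewrite ls; lra.
Qed.
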